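(* Let $n\ge 3$ and let $F$ be an infinite field of characteristic $\neq 2$. If $H$ is any group such that $H\equiv \mathrm{GL}_n(F)$, then $H$ fits into a short exact sequence $$1\rightarrow H'\cdot Z(H)\rightarrow H\rightarrow \frac{L^\times}{(L^\times)^n}\rightarrow 1,$$ where $H'\cong \mathrm{SL}_n(L)$ for a field $L\equiv F$ (as fields) and $Z(H)\equiv F^\times$.
   Context: $\equiv$ denotes elementary equivalence (language of groups for groups, language of rings for fields). $H'=[H,H]$ is the derived subgroup, $Z(H)$ the center, $L^\times$ the multiplicative group of $L$ and $(L^\times)^n$ its subgroup of $n$-th powers. The map $H'\cdot Z(H)\to H$ is the inclusion. *)

(* Defs.v *)
From HB Require Import structures.
From mathcomp Require Import all_boot all_order all_algebra.
From mathcomp Require Import boolp classical_sets cardinality.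

Set Implicit Arguments.
Unset Strict Implicit.
Unset Printing Implicit Defensive.

Import GRing.Theory.
Local Open Scope group_scope.

(* Signatures have function symbols only: equality is the only predicate,     *)
(* which is all that the languages of groups and of rings need.               *)
Record signature := Signature { symbol : Type; arity : symbol -> nat }.

Section Syntax.
Variable S : signature.

(* Terms and formulas are well scoped: the free variables of an element of    *)
(* [term n] or [formula n] are among the [n] variables indexed by ['I_n].     *)
Inductive term (n : nat) :=
| Var of 'I_n
| App (f : symbol S) of 'I_(arity f) -> term n.

(* Under a quantifier, the variable [ord0] is the bound one and the variable  *)
(* [i] of the context becomes [lift ord0 i].                                  *)
Inductive formula (n : nat) :=
| FEq of term n & term n
| FNot of formula n
| FAnd of formula n & formula n
| FOr of formula n & formula n
| FImp of formula n & formula n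
| FAll of formula n.+1
| FEx of formula n.+1.

Definition sentence := formula 0.

Record structure := Structure {
  carrier :> Type;
  interp : forall f : symbol S, ('I_(arity f) -> carrier) -> carrier }.

Variable M : structure.

Definition extend n (x : M) (e : 'I_n -> M) (i : 'I_n.+1) : M :=
  if unlift ord0 i is Some j then e j else x.

Fixpoint eval n (e : 'I_n -> M) (t : term n) : M :=
  match t with
  | Var i => e i
  | App f ts => interp (fun i => eval e (ts i))
  end.

Fixpoint holds n (e : 'I_n -> M) (phi : formula n) : Prop :=
  match phi with
  | FEq t u => eval e t = eval e u
  | FNot p => ~ holds e p
  | FAnd p q => holds e p /\ holds e q
  | FOr p q => holds e p \/ holds e q
  | FImp p q => holds e p -> holds e q
  | FAll p => forall x : M, holds (extend x e) p
  | FEx p => exists x : M, holds (extend x e) p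
  end.

Definition satisfies (phi : sentence) : Prop :=
  holds (fun i : 'I_0 => False_rect M (notF (ltn_ord i))) phi.

End Syntax.

Definition elementarily_equivalent (S : signature) (M N : structure S) : Prop :=
  forall phi : sentence S, satisfies M phi <-> satisfies N phi.

Inductive group_symbol := GOne | GInv | GMul.

Definition group_signature : signature :=
  Signature (fun f => match f with GOne => 0%N | GInv => 1%N | GMul => 2%N end).

Definition group_structure (G : groupType) : structure group_signature :=
  @Structure group_signature G (fun f =>
    match f return ('I_(@arity group_signature f) -> G) -> G with
    | GOne => fun _ => 1
    | GInv => fun a => (a ord0)^-1
    | GMul => fun a => a ord0 * a ord_max
    end).

Inductive ring_symbol := RZero | ROne | ROpp | RAdd | RMul.

Definition ring_signature : signature :=
  Signature (fun f =>
    match f with RZero | ROne => 0%N | ROpp => 1%N | RAdd | RMul => 2%N end).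

Definition ring_structure (R : nzRingType) : structure ring_signature :=
  @Structure ring_signature R (fun f =>
    match f return ('I_(@arity ring_signature f) -> R) -> R with
    | RZero => fun _ => 0%R
    | ROne => fun _ => 1%R
    | ROpp => fun a => (- a ord0)%R
    | RAdd => fun a => (a ord0 + a ord_max)%R
    | RMul => fun a => (a ord0 * a ord_max)%R
    end).

Definition group_equiv (G K : groupType) : Prop :=
  elementarily_equivalent (group_structure G) (group_structure K).

Definition field_equiv (K L : fieldType) : Prop :=
  elementarily_equivalent (ring_structure K) (ring_structure L).

Section Subgroup.
Variables (G : groupType) (S : groupClosed G).

Record subgroup := Subgroup { sgval : G; _ : sgval \in S }.

HB.instance Definition _ := [isSub for sgval].
HB.instance Definition _ := [Choice of subgroup by <:].

Fact subgroup_closed : group_closed (fun x => x \in S).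
Proof. by split; [exact: gpred1 | exact: gpredF]. Qed.

HB.instance Definition _ :=
  SubChoice_isSubGroup.Build G _ subgroup subgroup_closed.

Definition inclusion : UMagmaMorphism.type subgroup G := (val : subgroup -> G).

End Subgroup.

HB.mixin Record isNormalPred (G : groupType) (S : {pred G}) := {
  gpredJr : forall x y : G, x \in S -> x ^ y \in S
}.

#[short(type="normalClosed")]
HB.structure Definition NormalClosed (G : groupType) :=
  {S of isNormalPred G S & GroupClosed G S}.

Section Quotient.
Variables (G : groupType) (N : normalClosed G).

Definition coset_rel : rel G := fun x y => x^-1 * y \in N.

Fact coset_refl : reflexive coset_rel.
Proof. by move=> x; rewrite /coset_rel mulVg gpred1. Qed.

Fact coset_sym : symmetric coset_rel.
Proof. by move=> x y; rewrite /coset_rel -[RHS]gpredV invgM invgK. Qed.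

Fact coset_trans : transitive coset_rel.
Proof.
move=> y x z xy yz; rewrite /coset_rel -[z](mulVKg y) mulgA.
exact: gpredM.
Qed.

Canonical coset_equiv := EquivRel coset_rel coset_refl coset_sym coset_trans.

Definition quotient := {eq_quot coset_equiv}%qT.

HB.instance Definition _ := Choice.on quotient.

Definition coset_of (x : G) : quotient := (\pi_quotient x)%qT.

Lemma coset_eqE (x y : G) : (coset_of x == coset_of y) = (x^-1 * y \in N).
Proof. by rewrite /coset_of eqmodE. Qed.

Lemma coset_eqP (x y : G) : coset_of x = coset_of y <-> x^-1 * y \in N.
Proof. by rewrite -coset_eqE; split=> /eqP. Qed.

Definition coset_repr (u : quotient) : G := repr u.

Lemma coset_reprK : cancel coset_repr coset_of.
Proof. by move=> u; rewrite /coset_of /coset_repr; exact: reprK. Qed.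

Definition mul_coset (u v : quotient) : quotient :=
  coset_of (coset_repr u * coset_repr v).
Definition inv_coset (u : quotient) : quotient := coset_of (coset_repr u)^-1.

Lemma coset_ofM (x y : G) :
  mul_coset (coset_of x) (coset_of y) = coset_of (x * y).
Proof.
have /coset_eqP xN := coset_reprK (coset_of x).
have /coset_eqP yN := coset_reprK (coset_of y).
apply/coset_eqP; rewrite invgM.
set a := coset_repr _ in xN *; set b := coset_repr _ in yN *.
have -> : b^-1 * a^-1 * (x * y) = (a^-1 * x) ^ b * (b^-1 * y).
  by rewrite /conjg !mulgA mulgK.
by apply: gpredM => //; apply: gpredJr.
Qed.

Lemma coset_ofV (x : G) : inv_coset (coset_of x) = coset_of x^-1.
Proof.
have /coset_eqP xN := coset_reprK (coset_of x).
apply/coset_eqP; rewrite invgK.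
set a := coset_repr _ in xN *.
have -> : a * x^-1 = ((a^-1 * x)^-1) ^ a^-1.
  by rewrite /conjg invgM !invgK mulgK.
by apply: gpredJr; rewrite gpredV.
Qed.

Fact mul_cosetA : associative mul_coset.
Proof.
move=> u v w; rewrite -(coset_reprK u) -(coset_reprK v) -(coset_reprK w).
by rewrite !coset_ofM mulgA.
Qed.

Fact mul1_coset : left_id (coset_of 1) mul_coset.
Proof. by move=> u; rewrite -(coset_reprK u) coset_ofM mul1g. Qed.

Fact mul_coset1 : right_id (coset_of 1) mul_coset.
Proof. by move=> u; rewrite -(coset_reprK u) coset_ofM mulg1. Qed.

Fact mulV_coset : left_inverse (coset_of 1) inv_coset mul_coset.
Proof.
by move=> u; rewrite -(coset_reprK u) coset_ofV coset_ofM mulVg.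
Qed.

Fact mul_cosetV : right_inverse (coset_of 1) inv_coset mul_coset.
Proof.
by move=> u; rewrite -(coset_reprK u) coset_ofV coset_ofM mulgV.
Qed.

HB.instance Definition _ := isGroup.Build quotient
  mul_cosetA mul1_coset mul_coset1 mulV_coset mul_cosetV.

End Quotient.

Section Subgroups.
Variable G : groupType.

Definition center : {pred G} := [pred z | `[< forall x : G, z * x = x * z >]].

(* The subgroup generated by A, as the intersection of all the subgroups      *)
(* that contain A.                                                            *)
Definition generated (A : set G) : {pred G} :=
  [pred x | `[< forall S : groupClosed G,
                  (forall y, A y -> y \in S) -> x \in S >]].

Definition derived : {pred G} :=
  generated [set z | exists x y : G, z = [~ x, y]]%classic.

Definition prod_pred (A B : {pred G}) : {pred G} :=
  [pred x | `[< exists a b : G, [/\ a \in A, b \in B & x = a * b] >]].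

Fact center_closed : group_closed center.
Proof.
split=> [|x y /asboolP cx /asboolP cy]; apply/asboolP => z.
  by rewrite mul1g mulg1.
have cVy : y^-1 * z = z * y^-1 by rewrite -[z in LHS](mulgK y) -cy mulgA mulKg.
by rewrite -mulgA cVy !mulgA cx.
Qed.

Fact center_normal (x y : G) : x \in center -> x ^ y \in center.
Proof. by move=> /asboolP cx; rewrite /conjg cx mulKg; apply/asboolP. Qed.

HB.instance Definition _ :=
  isMulClosed.Build G center (group_closedM center_closed).
HB.instance Definition _ := isMul1Closed.Build G center center_closed.1.
HB.instance Definition _ :=
  isInvClosed.Build G center (group_closedV center_closed).
HB.instance Definition _ := isNormalPred.Build G center center_normal.

Fact generated_closed (A : set G) : group_closed (generated A).
Proof.
split=> [|x y /asboolP Ax /asboolP Ay]; apply/asboolP => S AS.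
  exact: gpred1.
by apply: gpredF; [exact: Ax | exact: Ay].
Qed.

HB.instance Definition _ (A : set G) :=
  isMulClosed.Build G (generated A) (group_closedM (generated_closed A)).
HB.instance Definition _ (A : set G) :=
  isMul1Closed.Build G (generated A) (generated_closed A).1.
HB.instance Definition _ (A : set G) :=
  isInvClosed.Build G (generated A) (group_closedV (generated_closed A)).
HB.instance Definition _ := GroupClosed.on derived.

Fact prod_pred_closed (A : groupClosed G) (N : normalClosed G) :
  group_closed (prod_pred A N).
Proof.
split=> [|_ _ /asboolP[a [b [Aa Nb ->]]] /asboolP[c [d [Ac Nd ->]]]].
  by apply/asboolP; exists 1, 1; rewrite mulg1; split=> //; exact: gpred1.
apply/asboolP; exists (a / c), ((b / d) ^ c^-1); split.
- exact: gpredF.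
- by apply: gpredJr; apply: gpredF.
- by rewrite /conjg invgK invgM !mulgA mulgVK.
Qed.

HB.instance Definition _ (A : groupClosed G) (N : normalClosed G) :=
  isMulClosed.Build G (prod_pred A N) (group_closedM (prod_pred_closed A N)).
HB.instance Definition _ (A : groupClosed G) (N : normalClosed G) :=
  isMul1Closed.Build G (prod_pred A N) (prod_pred_closed A N).1.
HB.instance Definition _ (A : groupClosed G) (N : normalClosed G) :=
  isInvClosed.Build G (prod_pred A N) (group_closedV (prod_pred_closed A N)).

End Subgroups.

Arguments center G : clear implicits.
Arguments derived G : clear implicits.

Definition isomorphic (G K : groupType) : Prop :=
  exists f : UMagmaMorphism.type G K, bijective f.

Definition short_exact (A B C : groupType)
    (i : UMagmaMorphism.type A B) (p : UMagmaMorphism.type B C) : Prop :=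
  [/\ injective i, range i = [set b | p b = 1]%classic & range p = setT].

Section GeneralLinear.
Variables (F : fieldType) (n : nat).

Record GL := MkGL { GL_mx :> 'M[F]_n; _ : GL_mx \in unitmx }.

HB.instance Definition _ := [isSub for GL_mx].
HB.instance Definition _ := [Choice of GL by <:].

Fact GL_one_subproof : (1%:M)%R \in @unitmx F n.
Proof. exact: unitmx1. Qed.

Fact GL_mul_subproof (A B : GL) : (A *m B)%R \in unitmx.
Proof. by rewrite unitmx_mul (valP A) (valP B). Qed.

Fact GL_inv_subproof (A : GL) : invmx A \in unitmx.
Proof. by rewrite unitmx_inv (valP A). Qed.

Definition GL_one : GL := MkGL GL_one_subproof.
Definition GL_mul (A B : GL) : GL := MkGL (GL_mul_subproof A B).
Definition GL_inv (A : GL) : GL := MkGL (GL_inv_subproof A).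

Fact GL_mulA : associative GL_mul.
Proof. by move=> A B C; apply: val_inj; exact: mulmxA. Qed.
Fact GL_1mul : left_id GL_one GL_mul.
Proof. by move=> A; apply: val_inj; exact: mul1mx. Qed.
Fact GL_mul1 : right_id GL_one GL_mul.
Proof. by move=> A; apply: val_inj; exact: mulmx1. Qed.
Fact GL_Vmul : left_inverse GL_one GL_inv GL_mul.
Proof. by move=> A; apply: val_inj; exact: (mulVmx (valP A)). Qed.
Fact GL_mulV : right_inverse GL_one GL_inv GL_mul.
Proof. by move=> A; apply: val_inj; exact: (mulmxV (valP A)). Qed.

HB.instance Definition _ :=
  isGroup.Build GL GL_mulA GL_1mul GL_mul1 GL_Vmul GL_mulV.

Definition SL_pred : {pred GL} := [pred A : GL | (\det A == 1)%R].

Fact SL_closed : group_closed SL_pred.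
Proof.
split=> [|A B /eqP dA /eqP dB]; rewrite inE; first exact/eqP/det1.
by rewrite det_mulmx det_inv dA dB invr1 mulr1.
Qed.

HB.instance Definition _ :=
  isMulClosed.Build GL SL_pred (group_closedM SL_closed).
HB.instance Definition _ := isMul1Closed.Build GL SL_pred SL_closed.1.
HB.instance Definition _ :=
  isInvClosed.Build GL SL_pred (group_closedV SL_closed).

Definition SL := subgroup SL_pred.
HB.instance Definition _ := Group.on SL.

End GeneralLinear.

Section MultiplicativeGroup.
Variable F : fieldType.

Record units := MkUnits { unitval :> F; _ : unitval != 0%R }.

HB.instance Definition _ := [isSub for unitval].
HB.instance Definition _ := [Choice of units by <:].

Fact units_mul_subproof (x y : units) : (unitval x * unitval y != 0)%R.
Proof. by rewrite mulf_neq0 ?(valP x) ?(valP y). Qed.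

Fact units_inv_subproof (x : units) : ((unitval x)^-1 != 0)%R.
Proof. by rewrite invr_neq0 ?(valP x). Qed.

Definition units_one : units := MkUnits (oner_neq0 F).
Definition units_mul (x y : units) : units := MkUnits (units_mul_subproof x y).
Definition units_inv (x : units) : units := MkUnits (units_inv_subproof x).

Fact units_mulA : associative units_mul.
Proof. by move=> x y z; apply: val_inj; exact: mulrA. Qed.
Fact units_1mul : left_id units_one units_mul.
Proof. by move=> x; apply: val_inj; exact: mul1r. Qed.
Fact units_mul1 : right_id units_one units_mul.
Proof. by move=> x; apply: val_inj; exact: mulr1. Qed.
Fact units_Vmul : left_inverse units_one units_inv units_mul.
Proof. by move=> x; apply: val_inj; exact: (mulVf (valP x)). Qed.
Fact units_mulV : right_inverse units_one units_inv units_mul.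
Proof. by move=> x; apply: val_inj; exact: (divff (valP x)). Qed.

HB.instance Definition _ :=
  isGroup.Build units units_mulA units_1mul units_mul1 units_Vmul units_mulV.

Lemma units_mulC (x y : units) : x * y = y * x.
Proof. by apply: val_inj; exact: mulrC. Qed.

Variable n : nat.

Definition powers : {pred units} :=
  [pred x | `[< exists y : units, x = y ^+ n >]].

Fact powers_closed : group_closed powers.
Proof.
split=> [|_ _ /asboolP[x ->] /asboolP[y ->]]; apply/asboolP.
  by exists 1; rewrite expg1n.
by exists (x / y); rewrite expgMn ?expVgn //; exact: units_mulC.
Qed.

Fact powers_normal (x y : units) : x \in powers -> x ^ y \in powers.
Proof. by rewrite /conjg units_mulC mulgK. Qed.

HB.instance Definition _ :=
  isMulClosed.Build units powers (group_closedM powers_closed).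
HB.instance Definition _ := isMul1Closed.Build units powers powers_closed.1.
HB.instance Definition _ :=
  isInvClosed.Build units powers (group_closedV powers_closed).
HB.instance Definition _ := isNormalPred.Build units powers powers_normal.

End MultiplicativeGroup.

Arguments powers F n : clear implicits.

(* Main.v *)
Require Import Defs.
From HB Require Import structures.
From mathcomp Require Import all_boot all_order all_algebra.
From mathcomp Require Import perm.
From mathcomp Require Import boolp classical_sets cardinality.
From mathcomp Require Import ring.

(** The idea is to name the field inside the group by a first-order condition on
    finitely many elements, strong enough that each choice in [GL F n] gives
    back [F] itself.

    The parameters [c] are [n] commuting independent involutions and one more
    element [u]. The centralizer of the involutions, called [torus], acts on
    the set of the conjugates of [u] under it, together with 1 ([root_elt]). As
    soon as the torus is abelian and this set is an abelian subgroup, it is a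
    field, with the group law as addition and u^s u^t = u^(st) as
    multiplication ([root_coordinate]). The condition [frame] adds that the
    elements of the torus of square 1 fix or invert [u], which lies outside the
    torus. If [F] is infinite of characteristic other than 2, each frame of
    [GL F n] is conjugate to one where the torus is diagonal ([frame_diagonal])
    and [u] is an elementary matrix ([root_shape]), so that the field it
    defines is a copy of [F] ([frame_coordinate]). Hence a frame of [H], which
    exists by transfer, defines a field [L], and translating ring sentences into
    group sentences quantified over frames yields that [L] is elementarily
    equivalent to [F] ([coordinate_equiv]).

    The structure of [H] over [L] is transferred as well. Each matrix of
    determinant 1 is a product of elementary matrices whose number is bounded in
    terms of [n] only ([SL_elem_product]). It follows that the following facts
    about [GL F n] are first-order in suitable parameters ([linear_structure]):
    words in root elements multiply as the corresponding products of elementary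
    matrices; commutators are words; each element is a word times an element of
    a subgroup of the torus; and an element of that subgroup is a word times a
    central element exactly when it dilates root elements by an [n]-th power. In
    [H] the words then form a copy of the special linear group over [L]
    ([SL_emb]), which is the derived subgroup because root elements are
    commutators ([derived_image]), and the dilation of the subgroup component
    gives the exact sequence ([exact_sequence]).

    Finally the center is definable without parameters, and the center of
    [GL F n] is the group of scalar matrices ([center_equiv]). *)

Set Implicit Arguments.
Unset Strict Implicit.
Unset Printing Implicit Defensive.

Import GRing.Theory.
Local Open Scope group_scope.

(** * Uniform definability in groups *)
Section Renaming.
Variable S : signature.

Fixpoint rename_term m n (r : 'I_m -> 'I_n) (t : term S m) : term S n :=
  match t with
  | Var i => Var S (r i)
  | App f ts => App (fun i => rename_term r (ts i))
  end.

(** The de Bruijn variable [ord0] is bound and stays fixed; the others shift. *)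
Definition lift_renaming m n (r : 'I_m -> 'I_n) (i : 'I_m.+1) : 'I_n.+1 :=
  if unlift ord0 i is Some j then lift ord0 (r j) else ord0.

Fixpoint rename_formula m (phi : formula S m) :
    forall n, ('I_m -> 'I_n) -> formula S n :=
  match phi with
  | FEq t u => fun n r => FEq (rename_term r t) (rename_term r u)
  | FNot p => fun n r => FNot (rename_formula p r)
  | FAnd p q => fun n r => FAnd (rename_formula p r) (rename_formula q r)
  | FOr p q => fun n r => FOr (rename_formula p r) (rename_formula q r)
  | FImp p q => fun n r => FImp (rename_formula p r) (rename_formula q r)
  | FAll p => fun n r => FAll (rename_formula p (lift_renaming r))
  | FEx p => fun n r => FEx (rename_formula p (lift_renaming r))
  end.

Variable M : structure S.

Lemma eval_rename m n (r : 'I_m -> 'I_n) (e : 'I_n -> M) (t : term S m) :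
  eval e (rename_term r t) = eval (fun i => e (r i)) t.
Proof.
by elim: t => //= f ts IH; congr (interp _); apply: funext => i; exact: IH.
Qed.

Lemma extend_lift m n (r : 'I_m -> 'I_n) (e : 'I_n -> M) (x : M) :
  (fun i => extend x e (lift_renaming r i)) = extend x (fun i => e (r i)).
Proof.
apply: funext => i; rewrite /extend /lift_renaming.
by case: (unlift ord0 i) => [j|]; rewrite ?liftK ?unlift_none.
Qed.

Lemma holds_rename m (phi : formula S m) n (r : 'I_m -> 'I_n) (e : 'I_n -> M) :
  holds e (rename_formula phi r) <-> holds (fun i => e (r i)) phi.
Proof.
elim: phi n r e => [k t u|k p IH|k p IHp q IHq|k p IHp q IHq|k p IHp q IHq
  |k p IH|k p IH] n r e /=.
- by rewrite !eval_rename.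
- by rewrite IH.
- by rewrite IHp IHq.
- by rewrite IHp IHq.
- by rewrite IHp IHq.
- by split=> h x; move: (h x); rewrite IH extend_lift.
- by split=> -[x h]; exists x; move: h; rewrite IH extend_lift.
Qed.

End Renaming.

Definition group_predicate (V : Type) := forall G : groupType, (V -> G) -> Prop.

(** One formula has to work in all groups at once: this uniformity is what lets
    a property pass between elementarily equivalent groups. Free variables are
    indexed by an arbitrary finite type, so that quantification over a family
    of elements is a change of index type and needs no variable numbering. *)
Definition definable (V : finType) (P : group_predicate V) : Prop :=
  exists phi : formula group_signature #|V|, forall (G : groupType) (e : V -> G),
    P G e <-> @holds _ (group_structure G) _ (fun i => e (enum_val i)) phi.

Definition term_definable (V : finType)
    (t : forall G : groupType, (V -> G) -> G) : Prop :=
  exists s : term group_signature #|V|, forall (G : groupType) (e : V -> G),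
    t G e = @eval _ (group_structure G) _ (fun i => e (enum_val i)) s.

Section Definability.
Variable V : finType.
Implicit Types (P Q : group_predicate V).
Implicit Types t u : forall G : groupType, (V -> G) -> G.

Lemma def_iff P Q :
  definable Q -> (forall G e, P G e <-> Q G e) -> definable P.
Proof. by move=> [phi phiP] PQ; exists phi => G e; rewrite PQ. Qed.

Lemma term_var (v : V) : term_definable (fun G e => e v).
Proof. by exists (Var _ (enum_rank v)) => G e; rewrite /= enum_rankK. Qed.

Lemma term_one : term_definable (fun G (e : V -> G) => 1).
Proof.
by exists (@App group_signature #|V| GOne
  (fun i : 'I_0 => False_rect _ (notF (ltn_ord i)))).
Qed.

Lemma term_inv t : term_definable t -> term_definable (fun G e => (t G e)^-1).
Proof.
move=> [s sP]; exists (@App group_signature _ GInv (fun _ => s)) => G e /=.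
by rewrite sP.
Qed.

Lemma term_mul t u : term_definable t -> term_definable u ->
  term_definable (fun G e => t G e * u G e).
Proof.
move=> [s sP] [r rP].
exists (@App group_signature _ GMul (fun i => if i == ord0 then s else r)) => G e /=.
by rewrite sP rP.
Qed.

Lemma term_exp t k : term_definable t -> term_definable (fun G e => t G e ^+ k).
Proof.
move=> tP; elim: k => [|k IH]; first exact: term_one.
have [s sP] := term_mul tP IH; exists s => G e.
by rewrite expgS sP.
Qed.

Lemma term_prod (I : Type) (r : seq I) (p : pred I)
    (t : forall G : groupType, (V -> G) -> I -> G) :
  (forall i, term_definable (fun G e => t G e i)) ->
  term_definable (fun G e => \prod_(i <- r | p i) t G e i).
Proof.
move=> tP; elim: r => [|i r [s sP]].
  by have [s sP] := term_one; exists s => G e; rewrite big_nil -sP.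
case pi: (p i).
  have [s' s'P] := term_mul (tP i) (ex_intro _ s sP : term_definable _).
  by exists s' => G e; rewrite big_cons pi -s'P.
by exists s => G e; rewrite big_cons pi -sP.
Qed.

Lemma term_conj t u : term_definable t -> term_definable u ->
  term_definable (fun G e => t G e ^ u G e).
Proof.
by move=> tP uP; apply: term_mul; [apply: term_inv|apply: term_mul].
Qed.

Lemma term_comm t u : term_definable t -> term_definable u ->
  term_definable (fun G e => [~ t G e, u G e]).
Proof.
by move=> tP uP; apply: term_mul; [apply: term_inv|apply: term_conj].
Qed.

Lemma def_eq t u : term_definable t -> term_definable u ->
  definable (fun G e => t G e = u G e).
Proof.
by move=> [s sP] [r rP]; exists (FEq s r) => G e /=; rewrite sP rP.
Qed.

Lemma def_not P : definable P -> definable (fun G e => ~ P G e).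
Proof. by move=> [p pP]; exists (FNot p) => G e /=; rewrite pP. Qed.

Lemma def_and P Q :
  definable P -> definable Q -> definable (fun G e => P G e /\ Q G e).
Proof.
by move=> [p pP] [q qP]; exists (FAnd p q) => G e /=; rewrite pP qP.
Qed.

Lemma def_or P Q :
  definable P -> definable Q -> definable (fun G e => P G e \/ Q G e).
Proof.
by move=> [p pP] [q qP]; exists (FOr p q) => G e /=; rewrite pP qP.
Qed.

Lemma def_imp P Q :
  definable P -> definable Q -> definable (fun G e => P G e -> Q G e).
Proof.
by move=> [p pP] [q qP]; exists (FImp p q) => G e /=; rewrite pP qP.
Qed.

Lemma def_equiv P Q :
  definable P -> definable Q -> definable (fun G e => P G e <-> Q G e).
Proof. by move=> dP dQ; apply: def_and; exact: def_imp. Qed.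

Lemma def_true : definable (fun G (e : V -> G) => True).
Proof.
have [phi phiP] := def_eq term_one term_one.
by exists phi => G e; split=> // _; apply/phiP.
Qed.

(** A proposition that mentions neither the group nor the variables is, by
    excluded middle, one of the two constant formulas. *)
Lemma def_const (p : Prop) : definable (fun G (e : V -> G) => p).
Proof.
have [hp|hp] := pselect p; first by apply: (def_iff def_true).
by apply: (def_iff (def_not def_true)) => G e; split=> // /(_ Logic.I).
Qed.

Lemma def_forall_fin (I : finType)
    (P : forall G : groupType, (V -> G) -> I -> Prop) :
  (forall i, definable (fun G e => P G e i)) ->
  definable (fun G e => forall i, P G e i).
Proof.
move=> Pi; suff dP (s : seq I) : definable (fun G e => forall i, i \in s -> P G e i).
  apply: (def_iff (dP (enum I))) => G e; split=> h i; first by move=> _; exact: h.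
  by apply: h; rewrite mem_enum.
elim: s => [|i s IH]; first by apply: (def_iff def_true).
apply: (def_iff (def_and (Pi i) IH)) => G e; split=> [h|[hi h] j].
  by split=> [|j js]; apply: h; rewrite inE ?eqxx ?js ?orbT.
by rewrite inE => /orP[/eqP->|/h].
Qed.

Lemma def_exists_fin (I : finType)
    (P : forall G : groupType, (V -> G) -> I -> Prop) :
  (forall i, definable (fun G e => P G e i)) ->
  definable (fun G e => exists i, P G e i).
Proof.
move=> Pi.
have dN := def_not (def_forall_fin (fun i => def_not (Pi i))).
apply: (def_iff dN) => G e; split=> [[i Pe] h|h]; first exact: h Pe.
by apply: contrapT => nP; apply: h => i Pe; apply: nP; exists i.
Qed.

End Definability.

Lemma def_reindex (V W : finType) (P : group_predicate V) (r : V -> W) :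
  definable P -> definable (fun G (e : W -> G) => P G (fun v => e (r v))).
Proof.
move=> [phi phiP].
exists (rename_formula phi (fun i => enum_rank (r (enum_val i)))) => G e.
rewrite holds_rename phiP.
suff -> : (fun i => e (r (enum_val i))) =
  (fun i : 'I_#|V| => e (enum_val (enum_rank (r (enum_val i))))) by [].
by apply: funext => i; rewrite enum_rankK.
Qed.

Section Quantifiers.
Variable V : finType.
Implicit Type Q : forall G : groupType, (V -> G) -> G -> Prop.

(** The bound variable is the new index [None]. Stated for a predicate of the
    environment and the bound element, the lemma applies to a goal of the form
    [forall x, _] by plain unification. *)
Lemma def_forall Q :
  definable (fun G (e : option V -> G) => Q G (fun v => e (Some v)) (e None)) ->
  definable (fun G (e : V -> G) => forall x : G, Q G e x).
Proof.
move=> [phi phiP].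
pose r (i : 'I_#|{: option V}|) : 'I_#|V|.+1 :=
  if enum_val i is Some v then lift ord0 (enum_rank v) else ord0.
exists (FAll (rename_formula phi r)) => G e /=.
pose e' x (o : option V) : G := if o is Some v then e v else x.
suff ext (x : G) : (Q G e x <-> @holds _ (group_structure G) _
    (extend (x : group_structure G) (fun i => e (enum_val i)))
    (rename_formula phi r)).
  by split=> h x; apply/ext; exact: h.
rewrite holds_rename; have := phiP G (e' x) => /=.
set s := (fun i => e' x _); set s' := (fun i => extend _ _ _).
suff -> : s = s' by [].
apply: funext => i; rewrite /s /s' /r /e'.
case: (enum_val i) => [v|]; rewrite /extend ?liftK ?unlift_none //.
by rewrite enum_rankK.
Qed.

Lemma def_exists Q :
  definable (fun G (e : option V -> G) => Q G (fun v => e (Some v)) (e None)) ->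
  definable (fun G (e : V -> G) => exists x : G, Q G e x).
Proof.
move=> dQ; have := def_not (def_forall (Q := fun G e x => ~ Q G e x) (def_not dQ)).
move=> /def_iff; apply=> G e; split=> [[x Qx] h|h]; first exact: h Qx.
by apply: contrapT => nQ; apply: h => x Qx; apply: nQ; exists x.
Qed.

End Quantifiers.

(** A finite family of elements is quantified one element at a time, after
    transport of the index type to an ordinal. *)
Lemma def_forall_fun (I V : finType)
    (Q : forall G : groupType, (V -> G) -> (I -> G) -> Prop) :
  definable (fun G (e : V + I -> G) =>
    Q G (fun v => e (inl v)) (fun i => e (inr i))) ->
  definable (fun G (e : V -> G) => forall f : I -> G, Q G e f).
Proof.
pose ordQ k := forall (W : finType)
    (Q : forall G : groupType, (W -> G) -> ('I_k -> G) -> Prop),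
  definable (fun G (e : W + 'I_k -> G) =>
    Q G (fun v => e (inl v)) (fun i => e (inr i))) ->
  definable (fun G (e : W -> G) => forall f : 'I_k -> G, Q G e f).
suff {Q} ordP k : ordQ k.
  move=> dQ.
  pose Q' (G : groupType) (e : V -> G) (f : 'I_#|I| -> G) := Q G e (fun i => f (enum_rank i)).
  apply: (def_iff (Q := fun G e => forall f : 'I_#|I| -> G, Q' G e f)).
    apply: ordP; rewrite /Q'.
    pose r (w : V + I) : V + 'I_#|I| :=
      match w with inl v => inl v | inr i => inr (enum_rank i) end.
    exact: (def_reindex r dQ).
  move=> G e; split=> h f; first exact: h.
  have := h (fun i => f (enum_val i)); rewrite /Q'.
  suff -> : (fun i => f (enum_val (enum_rank i))) = f by [].
  by apply: funext => i; rewrite enum_rankK.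
elim: k => [|k IH] W Q dQ.
  pose r (w : W + 'I_0) : W :=
    match w with inl v => v | inr i => False_rect W (notF (ltn_ord i)) end.
  apply: (def_iff (def_reindex r dQ)) => G e /=; split=> [h|h f]; first exact: h.
  by rewrite (_ : f = fun i => e (r (inr i))) //; apply: funext => -[].
pose cons (G : groupType) (x : G) (f : 'I_k -> G) (i : 'I_k.+1) : G :=
  if unlift ord0 i is Some j then f j else x.
apply: (def_iff (Q := fun G e => forall x, forall f : 'I_k -> G, Q G e (cons G x f))).
  apply: def_forall; apply: IH.
  pose r (w : W + 'I_k.+1) : option W + 'I_k :=
    match w with
    | inl v => inl (Some v)
    | inr i => if unlift ord0 i is Some j then inr j else inl None
    end.
  apply: (def_iff (def_reindex r dQ)) => G e /=.
  suff -> : (fun i => e (r (inr i))) = cons G (e (inl None)) (fun i => e (inr i)).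
    by [].
  by apply: funext => i; rewrite /r /cons; case: (unlift _ _).
move=> G e; split=> h => [x f|f]; first exact: h.
have := h (f ord0) (fun j => f (lift ord0 j)).
suff -> : cons G (f ord0) (fun j => f (lift ord0 j)) = f by [].
by apply: funext => i; rewrite /cons; case: unliftP => [j|] ->.
Qed.

Lemma def_exists_fun (I V : finType)
    (Q : forall G : groupType, (V -> G) -> (I -> G) -> Prop) :
  definable (fun G (e : V + I -> G) =>
    Q G (fun v => e (inl v)) (fun i => e (inr i))) ->
  definable (fun G (e : V -> G) => exists f : I -> G, Q G e f).
Proof.
move=> dQ.
have := def_not (def_forall_fun (Q := fun G e f => ~ Q G e f) (def_not dQ)).
move=> /def_iff; apply=> G e; split=> [[x Qx] h|h]; first exact: h Qx.
by apply: contrapT => nQ; apply: h => x Qx; apply: nQ; exists x.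
Qed.

Lemma transfer (G K : groupType) (P : groupType -> Prop) :
  group_equiv G K -> definable (fun G' (_ : void -> G') => P G') -> P G -> P K.
Proof.
move=> GK [phi phiP].
pose r (i : 'I_#|{: void}|) : 'I_0 := match enum_val i with end.
have sat (G' : groupType) :
    P G' <-> satisfies (group_structure G') (rename_formula phi r).
  have irr (e1 e2 : 'I_#|{: void}| -> group_structure G') :
      holds e1 phi <-> holds e2 phi.
    by rewrite (_ : e1 = e2) //; apply: funext => i; case: (enum_val i).
  rewrite /satisfies holds_rename.
  exact: iff_trans (phiP G' (fun v : void => match v with end)) (irr _ _).
by move=> /sat/GK/sat.
Qed.

Section Interpretation.
Variables (S : signature) (V : finType).
Variable dom : forall G : groupType, (V -> G) -> G -> Prop.
Variable graph : forall f : symbol S,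
  forall G : groupType, (V -> G) -> ('I_(arity f) -> G) -> G -> Prop.

(** Terms become graphs: interpreted operations need not be given by terms of
    the language of groups, so each subterm gets a witness for its value. *)
Fixpoint tr_term n (t : term S n) :
    forall G : groupType, (V -> G) -> ('I_n -> G) -> G -> Prop :=
  match t with
  | Var i => fun G c e y => y = e i
  | App f ts => fun G c e y => exists z : 'I_(arity f) -> G,
      (forall i, dom c (z i) /\ tr_term (ts i) c e (z i)) /\ graph c z y
  end.

Fixpoint tr_formula n (phi : formula S n) :
    forall G : groupType, (V -> G) -> ('I_n -> G) -> Prop :=
  match phi with
  | FEq t u => fun G c e => exists y, [/\ dom c y, tr_term t c e y & tr_term u c e y]
  | FNot p => fun G c e => ~ tr_formula p c e
  | FAnd p q => fun G c e => tr_formula p c e /\ tr_formula q c e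
  | FOr p q => fun G c e => tr_formula p c e \/ tr_formula q c e
  | FImp p q => fun G c e => tr_formula p c e -> tr_formula q c e
  | FAll p => fun G c e => forall x : G, dom c x ->
      tr_formula p c (@extend _ (group_structure G) _ x e)
  | FEx p => fun G c e => exists x : G, dom c x /\
      tr_formula p c (@extend _ (group_structure G) _ x e)
  end.

Definition interprets (G : groupType) (c : V -> G) (N : structure S)
    (rho : N -> G) : Prop :=
  [/\ injective rho, forall x, dom c x <-> exists a, x = rho a
    & forall f (z : 'I_(arity f) -> N) b,
        graph c (fun i => rho (z i)) (rho b) <-> b = interp z].

Section Correctness.
Variables (G : groupType) (c : V -> G) (N : structure S) (rho : N -> G).
Hypothesis rhoP : interprets c rho.

Lemma tr_termP n (t : term S n) (e : 'I_n -> N) b :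
  tr_term t c (fun i => rho (e i)) (rho b) <-> b = eval e t.
Proof.
have [rho_inj domP graphP] := rhoP.
elim: t b => [i|f ts IH] b /=; first by split=> [/rho_inj|->].
split=> [[z [zP]]|->].
  have /choice [a za] : forall i, exists a, z i = rho a.
    by move=> i; have [/domP] := zP i.
  have -> : z = fun i => rho (a i) by exact: funext.
  move=> /graphP->; congr (interp _); apply: funext => i.
  by apply/IH; rewrite -za; have [] := zP i.
exists (fun i => rho (eval e (ts i))); split=> [i|]; last exact/graphP.
by split; [apply/domP; eexists|apply/IH].
Qed.

(** The translation depends on the formula only, whereas the map [rho] may vary
    with the group and the parameters; a sentence thus holds in one interpreted
    structure exactly when its translation holds for the parameters. *)
Lemma tr_formulaP n (phi : formula S n) (e : 'I_n -> N) :
  tr_formula phi c (fun i => rho (e i)) <-> holds e phi.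
Proof.
have [rho_inj domP graphP] := rhoP.
have ext k (a : N) (e' : 'I_k -> N) :
    @extend _ (group_structure G) _ (rho a) (fun i => rho (e' i)) =
    (fun i => rho (extend a e' i)).
  by apply: funext => i; rewrite /extend; case: (unlift _ _).
elim: phi e => [k t u|k p IH|k p IHp q IHq|k p IHp q IHq|k p IHp q IHq
  |k p IH|k p IH] e /=.
- split=> [[y [/domP[a ->]]]|tu]; first by rewrite !tr_termP => <-.
  exists (rho (eval e t)); split; [by apply/domP; eexists|exact/tr_termP|].
  exact/tr_termP.
- by rewrite IH.
- by rewrite IHp IHq.
- by rewrite IHp IHq.
- by rewrite IHp IHq.
- split=> h => [a|_ /domP[a ->]]; last by rewrite ext; apply/IH; exact: h.
  by apply/IH; rewrite -ext; apply/h/domP; eexists.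
- split=> -[] => [_ [/domP[a ->]]|a /IH h].
    by rewrite ext => /IH h; exists a.
  by exists (rho a); rewrite ext; split=> //; apply/domP; eexists.
Qed.

End Correctness.

Hypothesis dom_def : definable (fun G (e : option V -> G) =>
  dom (fun v => e (Some v)) (e None)).
Hypothesis graph_def : forall f, definable
  (fun G (e : option (V + 'I_(arity f)) -> G) =>
     graph (f := f) (fun v => e (Some (inl v))) (fun i => e (Some (inr i)))
       (e None)).

Lemma def_dom (W : finType) (r : V -> W) (w : W) :
  definable (fun G (e : W -> G) => dom (fun v => e (r v)) (e w)).
Proof.
pose s (v : option V) : W := if v is Some v then r v else w.
exact: (def_reindex s dom_def).
Qed.

Lemma def_graph f (W : finType) (r : V -> W) (s : 'I_(arity f) -> W) (w : W) :
  definable (fun G (e : W -> G) =>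
    graph (f := f) (fun v => e (r v)) (fun i => e (s i)) (e w)).
Proof.
pose q (v : option (V + 'I_(arity f))) : W :=
  match v with Some (inl v) => r v | Some (inr i) => s i | None => w end.
exact: (def_reindex q (graph_def f)).
Qed.

Lemma def_tr_term n (t : term S n) (W : finType) (r : V -> W) (s : 'I_n -> W)
    (w : W) :
  definable (fun G (e : W -> G) =>
    tr_term t (fun v => e (r v)) (fun i => e (s i)) (e w)).
Proof.
elim: t W r s w => [i|f ts IH] W r s w /=.
  by apply: def_eq; exact: term_var.
apply: def_exists_fun; apply: def_and; last exact: def_graph.
by apply: def_forall_fin => i; apply: def_and; [exact: def_dom|exact: IH].
Qed.

Lemma def_tr_formula n (phi : formula S n) (W : finType) (r : V -> W)
    (s : 'I_n -> W) :
  definable (fun G (e : W -> G) =>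
    tr_formula phi (fun v => e (r v)) (fun i => e (s i))).
Proof.
have ext (k : nat) (W' : finType) (s' : 'I_k -> W') (G : groupType) (e : option W' -> G) :
    @extend _ (group_structure G) _ (e None) (fun i => e (Some (s' i))) =
    (fun i => e (if unlift ord0 i is Some j then Some (s' j) else None)).
  by apply: funext => i; rewrite /extend; case: (unlift _ _).
elim: phi W r s => [k t u|k p IH|k p IHp q IHq|k p IHp q IHq|k p IHp q IHq
  |k p IH|k p IH] W r s /=.
- apply: def_exists; apply: (def_iff (def_and (def_dom (Some \o r) None)
    (def_and (def_tr_term t (Some \o r) (Some \o s) None)
             (def_tr_term u (Some \o r) (Some \o s) None)))) => G e /=.
  by split=> [[]|[? []]].
- exact: def_not.
- exact: def_and.
- exact: def_or.
- exact: def_imp.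
- apply: def_forall; apply: def_imp; first exact: def_dom.
  have /def_iff := IH _ (Some \o r)
    (fun i => if unlift ord0 i is Some j then Some (s j) else None).
  by apply=> G e; rewrite ext.
- apply: def_exists; apply: def_and; first exact: def_dom.
  have /def_iff := IH _ (Some \o r)
    (fun i => if unlift ord0 i is Some j then Some (s j) else None).
  by apply=> G e; rewrite ext.
Qed.

End Interpretation.

(** * The field attached to a torus and a root element *)
Section RootGroup.
Variables (n : nat) (G : groupType) (c : option 'I_n -> G).

Definition torus (x : G) : Prop := forall i, c (Some i) * x = x * c (Some i).

Definition root_elt (x : G) : Prop := x = 1 \/ exists t, torus t /\ x = c None ^ t.

Definition frame_involutions : Prop :=
  (forall i, c (Some i) * c (Some i) = 1) /\
  (forall i j, c (Some i) * c (Some j) = c (Some j) * c (Some i)) /\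
  (forall S : {set 'I_n}, S != finset.set0 -> \prod_(i in S) c (Some i) <> 1).

(** No ring axiom is listed: conjugation by an abelian group that is transitive
    on the nontrivial elements of an abelian group makes it a field. *)
Definition root_field : Prop :=
  (forall s t, torus s -> torus t -> s * t = t * s) /\
  (forall x y, root_elt x -> root_elt y -> root_elt (x * y) /\ x * y = y * x) /\
  (forall x, root_elt x -> root_elt x^-1) /\
  c None <> 1.

(** This singles out root elements of [GL F n]. Applied to the diagonal
    reflections, it bounds the support of [c None] by a two by two block. *)
Definition root_reflection : Prop :=
  (forall t, torus t -> t * t = 1 -> c None ^ t = c None \/ c None ^ t = (c None)^-1) /\
  ~ torus (c None).

Definition frame : Prop := frame_involutions /\ root_field /\ root_reflection.

(** With [u := c None], the product of u^s and u^t is u^(st), and the neutral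
    element of the group, which is the zero of the field, is absorbing. *)
Definition root_graph (f : symbol ring_signature) :
    ('I_(arity f) -> G) -> G -> Prop :=
  match f return ('I_(@arity ring_signature f) -> G) -> G -> Prop with
  | RZero => fun z y => y = 1
  | ROne => fun z y => y = c None
  | ROpp => fun z y => y = (z ord0)^-1
  | RAdd => fun z y => y = z ord0 * z ord_max
  | RMul => fun z y => (z ord_max = 1 /\ y = 1) \/
      exists t, torus t /\ z ord_max = c None ^ t /\ y = z ord0 ^ t
  end.

Lemma torus1 : torus 1. Proof. by move=> i; rewrite mulg1 mul1g. Qed.

Lemma torusM s t : torus s -> torus t -> torus (s * t).
Proof. by move=> sP tP i; rewrite mulgA sP -!mulgA tP. Qed.

Lemma torusV t : torus t -> torus t^-1.
Proof. by move=> tP i; apply: commuteV; exact: tP. Qed.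

Lemma root1 : root_elt 1. Proof. by left. Qed.

Lemma root_unit : root_elt (c None).
Proof. by right; exists 1; rewrite conjg1; split=> //; exact: torus1. Qed.

Lemma rootJ x t : root_elt x -> torus t -> root_elt (x ^ t).
Proof.
move=> [->|[s [sP ->]]] tP; first by rewrite conj1g; exact: root1.
by right; exists (s * t); rewrite conjgM; split=> //; exact: torusM.
Qed.

Section Coordinates.
Variables (K : fieldType) (rho : K -> G).

(** A coordinate identifies a field with the set of root elements: addition with
    the group law, and multiplication by nonzero scalars with conjugation by the
    torus. It makes the field the one interpreted by [c]. *)
Definition coordinate : Prop :=
  [/\ injective rho,
      forall a b, rho (a + b)%R = rho a * rho b,
      rho 1%R = c None,
      forall t, torus t -> exists2 s, s != 0%R & forall a, rho a ^ t = rho (a * s)%R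
    & forall s, s != 0%R -> exists2 t, torus t & forall a, rho a ^ t = rho (a * s)%R].

Hypothesis rhoP : coordinate.

Lemma coordinate0 : rho 0%R = 1.
Proof.
have [_ rhoD _ _ _] := rhoP; apply: (mulgI (rho 0%R)).
by rewrite -rhoD addr0 mulg1.
Qed.

Lemma coordinate_root x : root_elt x <-> exists a, x = rho a.
Proof.
have [rho_inj rhoD rhou torusK Ktorus] := rhoP.
split=> [[->|[t [tP ->]]]|[a ->]].
- by exists 0%R; rewrite coordinate0.
- by have [s _ ts] := torusK t tP; exists s; rewrite -rhou ts mul1r.
- have [->|a0] := eqVneq a 0%R; first by rewrite coordinate0; left.
  by right; have [t tP ta] := Ktorus a a0; exists t; rewrite -rhou ta mul1r.
Qed.

Lemma coordinate_graph f (z : 'I_(@arity ring_signature f) -> ring_structure K)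
    (b : ring_structure K) :
  @root_graph f (fun i => rho (z i)) (rho b) <-> b = @interp _ (ring_structure K) f z.
Proof.
have [rho_inj rhoD rhou torusK Ktorus] := rhoP.
have rho0 := coordinate0.
case: f z => z /=.
- by rewrite -rho0; split=> [/rho_inj|->].
- by rewrite -rhou; split=> [/rho_inj|->].
- have rhoN a : (rho a)^-1 = rho (- a)%R.
    by apply/eqP; rewrite eq_sym -mulg_eq1 -rhoD addNr rho0.
  by rewrite rhoN; split=> [/rho_inj|->].
- by rewrite -rhoD; split=> [/rho_inj|->].
- split=> [[[]|[t [tP []]]]|->].
  + by rewrite -rho0 => /rho_inj-> /rho_inj->; rewrite mulr0.
  + have [s _ ts] := torusK t tP.
    by rewrite -rhou !ts mul1r => /rho_inj-> /rho_inj->.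
  + have [->|s0] := eqVneq (z ord_max) 0%R.
      by left; rewrite mulr0 rho0.
    right; have [t tP ta] := Ktorus _ s0; exists t.
    by rewrite -rhou !ta mul1r.
Qed.

End Coordinates.

Section Field.
Hypothesis cP : root_field.

Definition root_pred : pred G := fun x => `[< root_elt x >].

Record root_type := RootType { root_val :> G; _ : root_pred root_val }.

HB.instance Definition _ := [isSub for root_val].
HB.instance Definition _ := [Choice of root_type by <:].

Definition to_root (x : G) (xP : root_elt x) : root_type :=
  RootType (introT (asboolP _) xP : root_pred x).

Lemma root_valP (x : root_type) : root_elt (val x).
Proof. exact/asboolP/(valP x). Qed.

Lemma root_mul_closed (x y : root_type) : root_elt (val x * val y).
Proof. by case: cP => _ [/(_ _ _ (root_valP x) (root_valP y))[]]. Qed.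

Lemma root_inv_closed (x : root_type) : root_elt (val x)^-1.
Proof. by case: cP => _ [_ [/(_ _ (root_valP x))]]. Qed.

Definition root_add (x y : root_type) := to_root (root_mul_closed x y).
Definition root_opp (x : root_type) := to_root (root_inv_closed x).
Definition root_zero : root_type := to_root root1.
Definition root_one : root_type := to_root root_unit.

(** Only the class of this element modulo the centralizer of [c None] matters,
    as [root_mulE] shows. *)
Definition dilation (x : root_type) : G :=
  xget 1 [set t | torus t /\ val x = c None ^ t]%classic.

Lemma dilationP x : x != root_zero ->
  torus (dilation x) /\ val x = c None ^ dilation x.
Proof.
move=> x0; apply: (@xgetPex _ 1 [set t | torus t /\ val x = c None ^ t]%classic).
by have [x1|//] := root_valP x; case/eqP: x0; apply: val_inj.
Qed.

Lemma dilation_torus x : torus (dilation x).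
Proof.
by rewrite /dilation; case: xgetP => [t -> []|_] //; exact: torus1.
Qed.

Definition root_mul (x y : root_type) : root_type :=
  if y == root_zero then root_zero
  else to_root (rootJ (root_valP x) (dilation_torus y)).

Definition root_recip (x : root_type) : root_type :=
  if x == root_zero then root_zero
  else to_root (rootJ root_unit (torusV (dilation_torus x))).

Lemma torus_conjC s t x : torus s -> torus t -> (x ^ s) ^ t = (x ^ t) ^ s.
Proof.
by case: cP => torusC _ sP tP; rewrite -!conjgM torusC.
Qed.

(** The product does not depend on the choice of [t]: writing x = u^r, one gets
    x^t = u^(rt) = u^(tr) = y^r. *)
Lemma root_mulE x y t : torus t -> val y = c None ^ t ->
  val (root_mul x y) = val x ^ t.
Proof.
move=> tP yt; rewrite /root_mul; case: eqP => [y0|/eqP y0] /=.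
  case: cP => _ [_ [_ []]]; apply/eqP; rewrite -(conjg_eq1 _ t) -yt.
  by rewrite y0.
have [sP ys] := dilationP y0; set s := dilation y in sP ys *.
have [->|[r [rP ->]]] := root_valP x; first by rewrite !conj1g.
by rewrite !(torus_conjC _ rP) // -ys yt.
Qed.

Lemma root_mul0 x : root_mul x root_zero = root_zero.
Proof. by rewrite /root_mul eqxx. Qed.

Fact root_addA : associative root_add.
Proof. by move=> x y z; apply: val_inj; exact: mulgA. Qed.
Fact root_addC : commutative root_add.
Proof.
move=> x y; apply: val_inj => /=.
by case: cP => _ [/(_ _ _ (root_valP x) (root_valP y))[]].
Qed.
Fact root_add0 : left_id root_zero root_add.
Proof. by move=> x; apply: val_inj; exact: mul1g. Qed.
Fact root_addN : left_inverse root_zero root_opp root_add.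
Proof. by move=> x; apply: val_inj; exact: mulVg. Qed.

HB.instance Definition _ := GRing.isZmodule.Build root_type
  root_addA root_addC root_add0 root_addN.

(** Conjugation is an automorphism of the additive group. *)
Fact root_mulDl : left_distributive root_mul root_add.
Proof.
move=> x y z; have [->|z0] := eqVneq z root_zero.
  by rewrite !root_mul0 root_add0.
have [tP zt] := dilationP z0; apply: val_inj.
by rewrite (root_mulE _ tP zt) conjMg /= !(root_mulE _ tP zt).
Qed.

Lemma root_0mul x : root_mul root_zero x = root_zero.
Proof.
have [->|x0] := eqVneq x root_zero; first exact: root_mul0.
have [tP xt] := dilationP x0.
by apply: val_inj; rewrite (root_mulE _ tP xt) conj1g.
Qed.

Fact root_mulC : commutative root_mul.
Proof.
move=> x y; have [->|x0] := eqVneq x root_zero; first by rewrite root_0mul root_mul0.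
have [->|y0] := eqVneq y root_zero; first by rewrite root_0mul root_mul0.
have [[tP xt] [sP ys]] := (dilationP x0, dilationP y0).
by apply: val_inj; rewrite (root_mulE _ tP xt) (root_mulE _ sP ys) xt ys torus_conjC.
Qed.

Fact root_mulA : associative root_mul.
Proof.
move=> x y z; have [->|z0] := eqVneq z root_zero; first by rewrite !root_mul0.
have [->|y0] := eqVneq y root_zero; first by rewrite root_mul0 !root_0mul root_mul0.
have [[tP zt] [sP ys]] := (dilationP z0, dilationP y0).
have yz : val (root_mul y z) = c None ^ (dilation y * dilation z).
  by rewrite (root_mulE _ tP zt) conjgM -ys.
apply: val_inj; rewrite (root_mulE _ (torusM sP tP) yz) (root_mulE _ tP zt).
by rewrite (root_mulE _ sP ys) conjgM.
Qed.

Fact root_mul1 : left_id root_one root_mul.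
Proof.
move=> x; rewrite root_mulC; apply: val_inj.
by rewrite (@root_mulE x root_one 1 torus1) ?conjg1.
Qed.

Fact root_one_neq0 : root_one != 0%R.
Proof.
by apply/eqP => /(congr1 val) /=; case: cP => _ [_ []].
Qed.

HB.instance Definition _ := GRing.Zmodule_isComNzRing.Build root_type
  root_mulA root_mulC root_mul1 root_mulDl root_one_neq0.

Fact root_mulV x : x != 0%R -> (root_recip x * x = 1)%R.
Proof.
move=> x0; have [tP xt] := dilationP x0; apply: val_inj.
rewrite (root_mulE _ tP xt) /root_recip (negbTE x0) /=.
by rewrite -conjgM mulVg conjg1.
Qed.

Fact root_recip0 : root_recip 0%R = 0%R.
Proof. by rewrite /root_recip eqxx. Qed.

HB.instance Definition _ := GRing.ComNzRing_isField.Build root_type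
  root_mulV root_recip0.

Lemma root_coordinate : coordinate (fun x : root_type => val x).
Proof.
split=> //; first exact: val_inj.
- move=> t tP; exists (to_root (rootJ root_unit tP)).
    apply/eqP => /(congr1 val) /= ut; case: cP => _ [_ [_ []]].
    by apply/eqP; rewrite -(conjg_eq1 _ t); apply/eqP.
  by move=> x; rewrite (root_mulE x tP).
- move=> x x0; have [tP xt] := dilationP x0; exists (dilation x) => // y.
  by rewrite (root_mulE y tP xt).
Qed.

End Field.

Lemma exists_coordinate : root_field ->
  exists (L : fieldType) (rho : L -> G), coordinate rho.
Proof. by move=> cP; eexists; eexists; exact: (root_coordinate cP). Qed.

End RootGroup.

Lemma coordinate_interprets (n : nat) (G : groupType) (c : option 'I_n -> G)
    (K : fieldType) (rho : K -> G) :
  coordinate c rho ->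
  interprets (@root_elt n) (fun f G c => @root_graph n G c f) c
    (N := ring_structure K) rho.
Proof.
move=> rhoP; split; first by case: rhoP.
  exact: coordinate_root.
exact: coordinate_graph.
Qed.

Lemma coordinate_root_field (n : nat) (G : groupType) (c : option 'I_n -> G)
    (K : fieldType) (rho : K -> G) :
  coordinate c rho -> (forall s t, torus c s -> torus c t -> s * t = t * s) ->
  root_field c.
Proof.
move=> rhoP torusC; have [rho_inj rhoD rho1 _ _] := rhoP.
have rootP := coordinate_root rhoP; have rho0 := coordinate0 rhoP.
split=> //; split=> [x y /rootP[a ->] /rootP[b ->]|]; last split=> [x /rootP[a ->]|].
- by rewrite -!rhoD addrC; split=> //; apply/rootP; exists (b + a)%R.
- apply/rootP; exists (- a)%R; apply/esym/eqP.
  by rewrite -mulg_eq1 -rhoD addNr rho0.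
- by rewrite -rho0 -rho1 => /rho_inj/eqP; rewrite oner_eq0.
Qed.

(** * Definability of the interpreted field *)
Ltac term_definability := repeat first
  [ apply: term_var | apply: term_one | apply: term_inv | apply: term_conj
  | apply: term_comm | apply: term_mul | apply: term_exp
  | apply: term_prod => ? ].

Ltac definability := rewrite /=; repeat first
  [ apply: def_const
  | apply: def_eq; solve [term_definability]
  | apply: def_forall; rewrite /= | apply: def_exists; rewrite /=
  | apply: def_forall_fun; rewrite /= | apply: def_exists_fun; rewrite /=
  | apply: def_forall_fin => ? | apply: def_exists_fin => ?
  | apply: def_equiv | apply: def_imp | apply: def_and | apply: def_or | apply: def_not ].

Lemma def_frame (n : nat) (W : finType) (r : option 'I_n -> W) :
  definable (fun G (e : W -> G) => frame (fun v => e (r v))).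
Proof.
rewrite /frame /frame_involutions /root_field /root_reflection /root_elt /torus.
by definability.
Qed.

Lemma def_root (n : nat) (W : finType) (r : option 'I_n -> W) (w : W) :
  definable (fun G (e : W -> G) => root_elt (fun v => e (r v)) (e w)).
Proof. by rewrite /root_elt /torus; definability. Qed.

Lemma def_root_graph (n : nat) (f : symbol ring_signature) :
  definable (fun G (e : option (option 'I_n + 'I_(arity f)) -> G) =>
     @root_graph n G (fun v => e (Some (inl v))) f
       (fun i => e (Some (inr i))) (e None)).
Proof. by case: f; rewrite /root_graph /torus; definability. Qed.

Definition tr_ring (n : nat) := tr_formula (S := ring_signature)
  (fun G => @root_elt n G) (fun f G c => @root_graph n G c f).

Lemma def_tr_ring (n m : nat) (phi : formula ring_signature m) (W : finType)
    (r : option 'I_n -> W) (s : 'I_m -> W) :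
  definable (fun G (e : W -> G) =>
    tr_ring phi (fun v => e (r v)) (fun i => e (s i))).
Proof.
apply: def_tr_formula; first exact: def_root.
exact: def_root_graph.
Qed.

Lemma tr_ringP (n m : nat) (G : groupType) (c : option 'I_n -> G) (K : fieldType)
    (rho : K -> G) (phi : formula ring_signature m) (e : 'I_m -> K) :
  coordinate c rho ->
  tr_ring phi c (fun i => rho (e i)) <-> @holds _ (ring_structure K) _ e phi.
Proof. by move=> /coordinate_interprets rhoP; exact: tr_formulaP. Qed.

(** The translated sentence speaks about parameters, so it has to be quantified
    over all frames. The last hypothesis makes its truth independent of the
    frame in [G], since every frame there gives back the field [K]. *)
Lemma coordinate_equiv (n : nat) (G H : groupType) (K L : fieldType)
    (c : option 'I_n -> H) (rho : L -> H) :
  group_equiv H G -> frame c -> coordinate c rho ->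
  (forall c' : option 'I_n -> G, frame c' ->
     exists rho' : K -> G, coordinate c' rho') ->
  field_equiv L K.
Proof.
move=> HG cP rhoP GK.
suff imp (phi : sentence ring_signature) :
    satisfies (ring_structure L) phi -> satisfies (ring_structure K) phi.
  move=> phi; split=> [|Kphi]; first exact: imp.
  by apply: contrapT => Lphi; exact: (imp (FNot phi)) Lphi Kphi.
pose P (G : groupType) := exists c : option 'I_n -> G,
  frame c /\ tr_ring phi c (fun i : 'I_0 => False_rect G (notF (ltn_ord i))).
have noargs (M : fieldType) (G' : groupType) (f : M -> G') :
    (fun i : 'I_0 => False_rect G' (notF (ltn_ord i))) =
    (fun i => f (False_rect M (notF (ltn_ord i)))).
  by apply: funext => -[].
move=> Lphi; suff /(transfer HG) : definable (fun G (_ : void -> G) => P G).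
  case; first by exists c; split=> //; rewrite (noargs _ _ rho); exact/(tr_ringP _ _ rhoP).
  move=> c' [c'P]; have [rho' rho'P] := GK c' c'P.
  by rewrite (noargs _ _ rho') => /(tr_ringP _ _ rho'P).
apply: def_exists_fun; apply: def_and; first exact: def_frame.
apply: (def_iff (def_tr_ring phi inr
  (fun i : 'I_0 => False_rect (void + option 'I_n) (notF (ltn_ord i))))) => G' e.
have irr (z z' : 'I_0 -> G') :
    tr_ring phi (fun v => e (inr v)) z <-> tr_ring phi (fun v => e (inr v)) z'.
  by rewrite (_ : z = z') //; apply: funext => -[].
exact: irr.
Qed.

(** * Bounded generation of the special linear group *)
Definition offdiag (n : nat) := {p : 'I_n * 'I_n | p.1 != p.2}.
HB.instance Definition _ n := Finite.on (offdiag n).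

Section Elementary.
Local Open Scope ring_scope.
Variables (n : nat) (F : fieldType).
Implicit Types (i j r : 'I_n) (a b : F) (A B : 'M[F]_n).
Implicit Types w : seq (offdiag n * F).

Definition elem i j a : 'M[F]_n := 1%:M + a *: delta_mx i j.

Lemma elem_mulE i j a A r s :
  (elem i j a *m A) r s = A r s + (r == i)%:R * a * A j s.
Proof.
rewrite mulmxDl mul1mx -scalemxAl !mxE; congr (_ + _).
rewrite (bigD1 j) //= big1 => [|k kj]; rewrite !mxE ?eqxx ?andbT ?addr0.
  by rewrite mulrCA mulrA.
by rewrite (negbTE kj) andbF mul0r.
Qed.

Lemma mul_elemE i j a A r s :
  (A *m elem i j a) r s = A r s + (s == j)%:R * a * A r i.
Proof.
rewrite mulmxDr mulmx1 -scalemxAr !mxE; congr (_ + _).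
rewrite (bigD1 i) //= big1 => [|k ki]; rewrite !mxE ?eqxx ?addr0 /=.
  by rewrite (mulrC (A r i)) mulrA (mulrC a).
by rewrite (negbTE ki) mulr0.
Qed.

Lemma elemE i j a r s :
  elem i j a r s = (r == s)%:R + (r == i)%:R * (s == j)%:R * a.
Proof. by rewrite !mxE mulrC -mulnb natrM. Qed.

Lemma elem_mul i j a b : i != j -> elem i j a *m elem i j b = elem i j (a + b).
Proof.
move=> ij; apply/matrixP => r s; rewrite elem_mulE !elemE (eq_sym j i) (negbTE ij).
by rewrite mul0r mul0r addr0 mulrDr (eq_sym j s) -addrA (mulrAC _ a) (addrC (_ * b)).
Qed.

Lemma elem0 i j : elem i j 0 = 1%:M.
Proof. by rewrite /elem scale0r addr0. Qed.

Lemma det_elem i j a : i != j -> \det (elem i j a) = 1.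
Proof.
move=> ij; have [lt_ij|le_ji] := ltnP i j.
  rewrite -det_tr det_trig; last first.
    apply/is_trig_mxP => r s rs; rewrite mxE elemE.
    case: eqP => [srE|_]; first by rewrite srE ltnn in rs.
    case: eqP => [si|_]; last by rewrite mul0r mul0r addr0.
    case: eqP => [rj|_]; last by rewrite mulr0 mul0r addr0.
    by move: rs; rewrite rj si ltnNge ltnW.
  apply: big1 => r _; rewrite mxE elemE eqxx.
  case: eqP => [->|_]; last by rewrite mul0r mul0r addr0.
  by rewrite (negbTE ij) mulr0 mul0r addr0.
rewrite det_trig; last first.
  apply/is_trig_mxP => r s rs; rewrite elemE.
  case: eqP => [srE|_]; first by rewrite srE ltnn in rs.
  case: eqP => [ri|_]; last by rewrite mul0r mul0r addr0.
  case: eqP => [sj|_]; last by rewrite mulr0 mul0r addr0.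
  by move: rs; rewrite ri sj ltnNge le_ji.
apply: big1 => r _; rewrite elemE eqxx.
case: eqP => [->|_]; last by rewrite mul0r mul0r addr0.
by rewrite (negbTE ij) mulr0 mul0r addr0.
Qed.

(** A word records the positions and coefficients of a product of elementary
    matrices; it is evaluated here in matrices and below in groups. *)
Definition word_mx (s : seq (offdiag n * F)) : 'M[F]_n :=
  foldr (fun x A => elem (val x.1).1 (val x.1).2 x.2 *m A) 1%:M s.

Lemma word_mx_cat w1 w2 : word_mx (w1 ++ w2) = word_mx w1 *m word_mx w2.
Proof. by elim: w1 => [|x w1 IH] /=; rewrite ?mul1mx // IH mulmxA. Qed.

Lemma det_word_mx w : \det (word_mx w) = 1.
Proof.
elim: w => [|[[[i j] ij] a] w IH] /=; first by rewrite det1.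
by rewrite det_mulmx IH det_elem ?mulr1.
Qed.

Definition word_inv (s : seq (offdiag n * F)) : seq (offdiag n * F) :=
  rev [seq (x.1, - x.2) | x <- s].

Lemma word_mx_inv w : word_mx (word_inv w) *m word_mx w = 1%:M.
Proof.
elim: w => [|[[[i j] ij] a] w IH] /=; first by rewrite mul1mx.
rewrite /word_inv /= rev_cons -cats1 word_mx_cat /= mulmx1 -mulmxA.
by rewrite [X in _ *m X]mulmxA elem_mul // addNr elem0 mul1mx.
Qed.

Lemma word_mx_nseq0 k ij : word_mx (nseq k (ij, 0)) = 1%:M.
Proof. by elim: k => //= k ->; rewrite elem0 mulmx1. Qed.

Definition elem_product k A := exists2 w, (size w <= k)%N & A = word_mx w.

Lemma elem_productM k l A B : elem_product k A -> elem_product l B -> elem_product (k + l) (A *m B).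
Proof.
move=> [s sk ->] [t tl ->]; exists (s ++ t); last by rewrite word_mx_cat.
by rewrite size_cat leq_add.
Qed.

Lemma elem_productW k l A : (k <= l)%N -> elem_product k A -> elem_product l A.
Proof. by move=> kl [s sk ->]; exists s => //; exact: leq_trans kl. Qed.

Lemma elem_product1 k : elem_product k 1%:M.
Proof. by exists [::]. Qed.

Lemma elem_product_elem i j a : i != j -> elem_product 1 (elem i j a).
Proof.
by move=> ij; exists [:: (exist _ (i, j) ij : offdiag n, a)]; rewrite //= mulmx1.
Qed.

Lemma elem_product_det k A : elem_product k A -> \det A = 1.
Proof. by move=> [s _ ->]; exact: det_word_mx. Qed.

Lemma elem_product_inv k A : elem_product k A -> exists2 B, elem_product k B & B *m A = 1%:M.
Proof.
move=> [s sk ->]; exists (word_mx (word_inv s)); last exact: word_mx_inv.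
by exists (word_inv s); rewrite // size_rev size_map.
Qed.

Definition reduces k A B := exists P Q, [/\ elem_product k P, elem_product k Q & B = P *m A *m Q].

Lemma reduces_trans k l A B C :
  reduces k A B -> reduces l B C -> reduces (k + l) A C.
Proof.
move=> [P [Q [sP sQ ->]]] [P' [Q' [sP' sQ' ->]]].
exists (P' *m P), (Q *m Q'); rewrite !mulmxA; split=> //.
  by rewrite addnC; exact: elem_productM.
exact: elem_productM.
Qed.

Lemma reduces_det k A B : reduces k A B -> \det B = \det A.
Proof.
move=> [P [Q [/elem_product_det dP /elem_product_det dQ ->]]].
by rewrite !det_mulmx dP dQ mul1r mulr1.
Qed.

Definition reduced_to k A := forall i j, (i < k)%N || (j < k)%N -> A i j = (i == j)%:R.

Lemma elem_product_column (k : 'I_n) (v : 'I_n -> F) (r : seq 'I_n) : k \notin r ->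
  elem_product (size r) (1%:M + \sum_(i <- r) v i *: delta_mx i k).
Proof.
elim: r => [|i r IH]; first by rewrite big_nil addr0 => _; exact: elem_product1.
rewrite inE negb_or big_cons => /andP[ki kr].
suff -> : 1%:M + (v i *: delta_mx i k + \sum_(j <- r) v j *: delta_mx j k) =
    elem i k (v i) *m (1%:M + \sum_(j <- r) v j *: delta_mx j k).
  by apply: (@elem_productM 1); [apply: elem_product_elem; rewrite eq_sym|exact: IH].
rewrite mulmxDl mul1mx mulmxDr mulmx1 mulmx_sumr [X in _ = _ + (_ + X)]big1_seq.
  by rewrite addr0 [in RHS]addrAC addrA.
move=> j /= jr; rewrite -scalemxAl -scalemxAr mul_delta_mx_0 ?scaler0 //.
by apply: contraNneq kr => ->.
Qed.

Lemma elem_product_row (k : 'I_n) (v : 'I_n -> F) (r : seq 'I_n) : k \notin r ->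
  elem_product (size r) (1%:M + \sum_(j <- r) v j *: delta_mx k j).
Proof.
elim: r => [|i r IH]; first by rewrite big_nil addr0 => _; exact: elem_product1.
rewrite inE negb_or big_cons => /andP[ki kr].
suff -> : 1%:M + (v i *: delta_mx k i + \sum_(j <- r) v j *: delta_mx k j) =
    elem k i (v i) *m (1%:M + \sum_(j <- r) v j *: delta_mx k j).
  by apply: (@elem_productM 1); [apply: elem_product_elem|exact: IH].
rewrite mulmxDl mul1mx mulmxDr mulmx1 mulmx_sumr [X in _ = _ + (_ + X)]big1.
  by rewrite addr0 [in RHS]addrAC addrA.
move=> j _; rewrite -scalemxAl -scalemxAr mul_delta_mx_0 ?scaler0 //.
by rewrite eq_sym.
Qed.

Definition others (k : 'I_n) := rem k (enum 'I_n).

Lemma others_notin (k : 'I_n) : k \notin others k.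
Proof. by rewrite mem_rem_uniqF ?enum_uniq. Qed.

Lemma size_others (k : 'I_n) : (size (others k) <= n)%N.
Proof. by rewrite size_rem ?mem_enum // size_enum_ord leq_pred. Qed.

Lemma sum_others (k : 'I_n) (G : zmodType) (f : 'I_n -> G) :
  \sum_(i <- others k) f i = \sum_(i | i != k) f i.
Proof.
by rewrite /others rem_filter ?enum_uniq // big_filter big_enum_cond.
Qed.

(** The rows and columns of a pivot equal to 1 are cleared by one product of
    elementary matrices in the pivot column and one in the pivot row. *)
Lemma clear_cross (k : 'I_n) A : A k k = 1 ->
  exists2 B, reduces n A B &
    forall r s, B r s = if r == k then (s == k)%:R
                        else A r s - A r k * A k s.
Proof.
move=> Akk.
pose P : 'M_n := 1%:M + \sum_(i <- others k) (- A i k) *: delta_mx i k.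
pose Q : 'M_n := 1%:M + \sum_(j <- others k) (- A k j) *: delta_mx k j.
exists (P *m A *m Q).
  exists P, Q; split=> //; apply: (elem_productW (size_others k)).
    exact: (elem_product_column (fun i => - A i k) (others_notin k)).
  exact: (elem_product_row (fun j => - A k j) (others_notin k)).
have PA r s : (P *m A) r s = A r s - (r != k)%:R * A r k * A k s.
  rewrite mulmxDl mul1mx mulmx_suml mxE; congr (_ + _).
  rewrite sum_others summxE.
  have E i : ((- A i k *: delta_mx i k) *m A) r s = (r == i)%:R * (- A i k * A k s).
    have := elem_mulE i k (- A i k) A r s; rewrite /elem mulmxDl mul1mx [LHS]mxE.
    by move/addrI->; rewrite mulrA.
  have [rk|rk] := eqVneq r k.
    rewrite big1 ?mul0r ?oppr0 // => i ik.
    by rewrite E rk eq_sym (negbTE ik) mul0r.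
  rewrite (bigD1 r) //= E eqxx !mul1r big1 ?addr0 ?mulNr // => i /andP[_ ir].
  by rewrite E eq_sym (negbTE ir) mul0r.
move=> r s; rewrite mulmxDr mulmx1 mulmx_sumr mxE sum_others summxE.
have E j : ((P *m A) *m (- A k j *: delta_mx k j)) r s =
    (s == j)%:R * (- A k j * (P *m A) r k).
  have := mul_elemE k j (- A k j) (P *m A) r s; rewrite /elem mulmxDr mulmx1 [LHS]mxE.
  by move/addrI->; rewrite mulrA.
have col : (P *m A) r k = (r == k)%:R.
  rewrite PA Akk mulr1; case: eqP => [->|_] /=; first by rewrite mul0r subr0.
  by rewrite mul1r subrr.
rewrite [X in _ + X](eq_bigr (fun j => (s == j)%:R * (- A k j * (r == k)%:R))); last first.
  by move=> j _; rewrite E col.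
case: eqP => [rk|rk]; last first.
  rewrite big1 ?addr0 => [|j _]; last by rewrite !mulr0.
  by rewrite PA; case: eqP => // _; rewrite mul1r.
rewrite PA rk eqxx mul0r mul0r subr0; have [->|sk] := eqVneq s k.
  rewrite big1 ?addr0 // => j jk; by rewrite eq_sym (negbTE jk) mul0r.
rewrite (bigD1 s) //= eqxx mul1r mulr1 big1 ?addr0 ?subrr // => j /andP[_ js].
by rewrite eq_sym (negbTE js) mul0r.
Qed.

Lemma reduces_elem i j a A : i != j -> reduces 1 A (elem i j a *m A).
Proof.
move=> ij; exists (elem i j a), 1%:M; rewrite mulmx1; split=> //.
  exact: elem_product_elem.
exact: elem_product1.
Qed.

(** If the entries of column [k] below the diagonal vanish, the diagonal one does
    not, and
    adding row [k] to the next row creates a nonzero entry below the diagonal.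
    This is why the last row is excluded. *)
Lemma pivot_one (k : 'I_n) A : reduced_to k A -> \det A != 0 -> (k.+1 < n)%N ->
  exists2 B, reduces 2 A B & reduced_to k B /\ B k k = 1.
Proof.
have below i A' : (k < i)%N -> reduced_to k A' -> A' i k != 0 ->
    exists2 B, reduces 1 A' B & reduced_to k B /\ B k k = 1.
  move=> ki red nz; have ki' : k != i by rewrite -val_eqE /= ltn_eqF.
  exists (elem k i ((1 - A' k k) / A' i k) *m A'); first exact: reduces_elem.
  split=> [r s rs|]; last by rewrite elem_mulE eqxx mul1r divfK // addrC subrK.
  rewrite elem_mulE red //; case: (eqVneq r k) => [rk|_]; last by rewrite !mul0r addr0.
  move: rs; rewrite rk ltnn /= => sk.
  have si : i == s = false by rewrite -val_eqE /= gtn_eqF // (ltn_trans sk).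
  by rewrite (red i s) ?sk ?orbT // si mulr0 addr0.
move=> red dA kn.
have [/existsP[i /andP[ki nz]]|] := boolP [exists i : 'I_n, (k < i)%N && (A i k != 0)].
  have [B AB BP] := below i A ki red nz; exists B => //.
  have [P [Q [sP sQ ->]]] := AB.
  by exists P, Q; split=> //; apply: (elem_productW (leqnSn 1)).
rewrite negb_exists => /forallP zero; pose k1 := Ordinal kn.
have k1k : k1 != k by rewrite -val_eqE /= gtn_eqF.
have Akk : A k k != 0.
  apply: contraNneq dA => Akk0; rewrite -det_tr (expand_det_row _ k).
  rewrite big1 // => j _; rewrite mxE.
  have [jk|] := ltnP j k; first by rewrite red ?jk // -val_eqE /= ltn_eqF // mul0r.
  rewrite leq_eqVlt => /orP[/eqP/val_inj <-|kj]; first by rewrite Akk0 mul0r.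
  by have := zero j; rewrite kj /= negbK => /eqP->; rewrite mul0r.
have red1 : reduced_to k (elem k1 k 1 *m A).
  move=> r s rs; rewrite elem_mulE (red r s rs).
  case: (eqVneq r k1) => [rk|_]; last by rewrite !mul0r addr0.
  move: rs; rewrite rk /= ltnNge leqnSn /= => sk.
  have ks : k == s = false by rewrite -val_eqE /= gtn_eqF.
  by rewrite (red k s) ?sk ?orbT // ks mulr0 addr0.
have [||B AB BP] := below k1 (elem k1 k 1 *m A) _ red1; first exact: leqnn.
  have -> : (elem k1 k 1 *m A) k1 k = A k k.
    rewrite elem_mulE eqxx !mul1r; have := zero k1; rewrite /= leqnn /= negbK => /eqP->.
    by rewrite add0r.
  by [].
by exists B => //; apply: (@reduces_trans 1 1 _ _ _ (reduces_elem 1 A k1k) AB).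
Qed.

Lemma reduce_step (k : 'I_n) A : reduced_to k A -> \det A != 0 -> (k.+1 < n)%N ->
  exists2 B, reduces (2 + n) A B & reduced_to k.+1 B.
Proof.
move=> red dA kn; have [B AB [redB Bkk]] := pivot_one red dA kn.
have [C BC CE] := clear_cross Bkk.
exists C; first exact: reduces_trans AB BC.
move=> r s rs; rewrite CE; have [->|rk] := eqVneq r k; first by rewrite eq_sym.
have [->|sk] := eqVneq s k.
  by rewrite Bkk mulr1 subrr (negbTE rk).
have rs' : (r < k)%N || (s < k)%N.
  have lt_k i : (i < k.+1)%N -> i != k -> (i < k)%N.
    by rewrite ltnS leq_eqVlt => /orP[/eqP/val_inj->|//]; rewrite eqxx.
  by case/orP: rs => [/lt_k->|/lt_k->] //; rewrite orbT.
rewrite redB //; case/orP: rs' => [rk'|sk'].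
  by rewrite (redB r k) ?rk' // (negbTE rk) mul0r subr0.
by rewrite (redB k s) ?sk' ?orbT // (eq_sym k s) (negbTE sk) mulr0 subr0.
Qed.

Lemma reduce_steps A : \det A != 0 -> forall k, (k < n)%N ->
  exists2 B, reduces (k * (2 + n)) A B & reduced_to k B.
Proof.
move=> dA; elim=> [|k IH] kn.
  exists A; last by move=> i j; rewrite ltn0.
  by exists 1%:M, 1%:M; rewrite mul1mx mulmx1; split=> //; exact: elem_product1.
have [B AB red] := IH (ltnW kn).
have [||C BC redC] := @reduce_step (Ordinal (ltnW kn)) B red.
- by rewrite (reduces_det AB).
- exact: kn.
exists C => //; rewrite mulSn addnC; exact: reduces_trans AB BC.
Qed.

(** Gaussian elimination with a number of steps that depends on the size only.
    This uniform bound makes membership in the special linear group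
    expressible by a single formula with coefficients as variables. *)
Lemma SL_elem_product A : \det A = 1 -> elem_product (n * (2 + n) + n * (2 + n)) A.
Proof.
case: (posnP n) => [n0 _|n_gt0 dA].
  by exists [::] => //; apply/matrixP => i; have := ltn_ord i; rewrite [X in (_ < X)%N]n0.
have [||B [P [Q [sP sQ BE]]] red] := @reduce_steps A _ n.-1 _.
- by rewrite dA oner_neq0.
- by rewrite prednK.
have last_row i : ~~ (i < n.-1)%N -> i = n.-1 :> nat.
  by rewrite -leqNgt => h; apply/eqP; rewrite eqn_leq h -ltnS prednK ?ltn_ord.
have B1 : B = 1%:M.
  have off i j : i != j -> B i j = 0.
    move=> ij; rewrite red ?(negbTE ij) //; apply: contraNT ij.
    by rewrite negb_or -val_eqE /= => /andP[/last_row-> /last_row->].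
  have Bdiag : B = diag_mx (\row_i B i i).
    apply/matrixP => i j; rewrite !mxE; case: eqP => [->|/eqP ij].
      by rewrite mulr1n.
    by rewrite off.
  pose l := Ordinal (etrans (congr1 (fun k => n.-1 < k)%N (esym (prednK n_gt0))) (leqnn _)).
  have Bl : B l l = 1.
    have := reduces_det (ex_intro _ P (ex_intro _ Q (And3 sP sQ BE))).
    rewrite dA {1}Bdiag det_diag (bigD1 l) //= mxE big1 ?mulr1 // => i il.
    rewrite mxE red ?eqxx //; apply/orP; left; apply: contraNT il => /last_row il.
    exact/eqP/val_inj.
  apply/matrixP => i j; rewrite mxE; have [<-|ij] := eqVneq i j; last by rewrite off.
  have [il|/last_row il] := boolP (i < n.-1)%N; first by rewrite red ?il ?eqxx.
  by rewrite (_ : i = l) //; exact: val_inj.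
have [P' sP' P'P] := elem_product_inv sP; have [Q' sQ' Q'Q] := elem_product_inv sQ.
have QQ' := mulmx1C Q'Q.
have -> : A = P' *m Q'.
  rewrite -[LHS]mul1mx -P'P -[LHS]mulmx1 -QQ' !mulmxA -(mulmxA P') -(mulmxA P') -BE B1.
  by rewrite mulmx1.
apply: elem_productM; [apply: elem_productW sP'|apply: elem_productW sQ'];
  by rewrite leq_mul2r leq_pred orbT.
Qed.

End Elementary.

(** * Linear structure as a first-order condition *)
Section WordFormula.
Variables (n m : nat).

Notation rterm := (term ring_signature m).

Definition ring_const (f : ring_symbol) (f0 : @arity ring_signature f = 0%N) : rterm :=
  @App ring_signature m f
    (fun i => False_rect _ (notF (ltn_ord (cast_ord f0 i)))).

Definition ring_binary (f : ring_symbol) (t u : rterm) : rterm :=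
  @App ring_signature m f (fun i => if val i == 0%N then t else u).

Definition id_term (r s : 'I_n) : rterm :=
  if r == s then @ring_const ROne erefl else @ring_const RZero erefl.

Fixpoint word_term (w : seq (offdiag n * rterm)) (r s : 'I_n) : rterm :=
  match w with
  | [::] => id_term r s
  | x :: w' => if r == (val x.1).1
               then ring_binary RAdd (word_term w' r s)
                      (ring_binary RMul x.2 (word_term w' (val x.1).2 s))
               else word_term w' r s
  end.

Definition conj_formula (I : Type) (r : seq I) (f : I -> formula ring_signature m) :=
  foldr (fun i phi => FAnd (f i) phi)
    (FEq (@ring_const ROne erefl) (@ring_const ROne erefl)) r.

(** The ring formula in the coefficients of a word which says that the product
    of its elementary matrices is the identity. *)
Definition word_formula (p : m.-tuple (offdiag n)) : formula ring_signature m :=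
  conj_formula (enum {: 'I_n * 'I_n}) (fun rs =>
    FEq (word_term [seq (tnth p k, Var _ k) | k <- enum 'I_m] rs.1 rs.2)
        (id_term rs.1 rs.2)).

Variables (K : fieldType) (e : 'I_m -> K).
Notation ev := (@eval ring_signature (ring_structure K) m e).

Lemma eval_id_term r s : ev (id_term r s) = (r == s)%:R%R.
Proof. by rewrite /id_term; case: eqP. Qed.

Lemma eval_word_term (w : seq (offdiag n * rterm)) r s :
  ev (word_term w r s) = word_mx [seq (x.1, ev x.2 : K) | x <- w] r s.
Proof.
elim: w r s => [|x w IH] r s /=; first by rewrite eval_id_term mxE.
rewrite elem_mulE; case: eqP => [->|_] /=; last by rewrite !mul0r addr0 IH.
by rewrite !IH mul1r.
Qed.

Lemma holds_conj (I : eqType) (r : seq I) (f : I -> formula ring_signature m) :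
  @holds _ (ring_structure K) m e (conj_formula r f) <->
  forall i, i \in r -> @holds _ (ring_structure K) m e (f i).
Proof.
elim: r => [|i r IH] //=; rewrite -/(conj_formula r f) IH.
split=> [[fi fr] j|fr]; first by rewrite inE => /orP[/eqP->|/fr].
by split=> [|j jr]; apply: fr; rewrite inE ?eqxx // jr orbT.
Qed.

Lemma word_formulaP (p : m.-tuple (offdiag n)) :
  @holds _ (ring_structure K) m e (word_formula p) <->
  word_mx [seq (tnth p k, e k) | k <- enum 'I_m] = 1%:M%R.
Proof.
rewrite /word_formula holds_conj; split=> [h|h].
  apply/matrixP => r s; have := h (r, s); rewrite mem_enum => /(_ isT) /=.
  by rewrite eval_word_term eval_id_term -map_comp [X in _ -> _ = X]mxE.
move=> [r s] _ /=.
by rewrite eval_word_term eval_id_term -map_comp h mxE.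
Qed.

End WordFormula.

Section LinearStructure.
Variables (n N : nat) (G : groupType).
Variables (c : option 'I_n -> G) (w : offdiag n -> G) (y : G).

Definition is_word (g : G) : Prop :=
  exists p : N.-tuple (offdiag n), exists a : 'I_N -> G,
    (forall k, root_elt c (a k)) /\ g = \prod_(k < N) a k ^ w (tnth p k).

Definition subtorus (t : G) : Prop := torus c t /\ t * y = y * t.

(** A word is trivial in the group exactly when it is trivial as a matrix. Words
    of triple length express that the value of a product of two words is the
    product of their values, for any third word that represents it. *)
Definition words_faithful : Prop :=
  forall (p : (N + N + N).-tuple (offdiag n)) (a : 'I_(N + N + N) -> G),
    (forall k, root_elt c (a k)) ->
    (tr_ring (word_formula p) c a <->
     \prod_(k < N + N + N) a k ^ w (tnth p k) = 1).

(** In [GL F n] the words are the matrices of determinant 1, and [subtorus] is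
    the group of the matrices diag(a, b, ..., b). Such a matrix has
    determinant (a / b) b^n, hence is a scalar times a matrix of determinant 1
    exactly when a / b is an [n]-th power. The last clause says that a / b takes
    all nonzero values. *)
Definition linear_structure : Prop :=
  words_faithful /\
  (forall g h, is_word [~ g, h]) /\
  (forall g, exists x, exists t, is_word x /\ subtorus t /\ g = x * t) /\
  (forall t, subtorus t ->
     ((exists x, exists z, is_word x /\ (forall g, z * g = g * z) /\ t = x * z) <->
      (exists s, torus c s /\ c None ^ t = c None ^ (s ^+ n)))) /\
  (forall t, torus c t -> exists s, subtorus s /\ c None ^ s = c None ^ t).

End LinearStructure.

Lemma def_linear_structure (n N : nat) (W : finType) (r : option 'I_n -> W)
    (q : offdiag n -> W) (v : W) :
  definable (fun G (e : W -> G) =>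
    linear_structure N (fun i => e (r i)) (fun i => e (q i)) (e v)).
Proof.
rewrite /linear_structure; apply: def_and.
  rewrite /words_faithful; apply: def_forall_fin => p; apply: def_forall_fun.
  apply: def_imp; first by rewrite /root_elt /torus; definability.
  apply: def_equiv; first exact: (@def_tr_ring n _ _ _ (fun i => inl (r i)) inr).
  by definability.
rewrite /is_word /subtorus /root_elt /torus.
by definability.
Qed.

(** * Consequences of the linear structure *)
Lemma prod_enum_ord (G : groupType) k (f : 'I_k -> G) :
  \prod_(i <- enum 'I_k) f i = \prod_(i < k) f i.
Proof. by rewrite [index_enum _]unlock enumT. Qed.

Definition SL_width (n : nat) : nat := n * (2 + n) + n * (2 + n).

Section Structure.
Variables (n : nat) (H : groupType).
Variables (c : option 'I_n -> H) (w : offdiag n -> H) (y : H).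
Variables (L : fieldType) (rho : L -> H).
Variable ij0 : offdiag n.
Let N := SL_width n.
Hypothesis cP : frame c.
Hypothesis rhoP : coordinate c rho.
Hypothesis HP : linear_structure N c w y.

Let rho_inj : injective rho. Proof. by case: rhoP. Qed.
Let rhoD a b : rho (a + b)%R = rho a * rho b. Proof. by case: rhoP. Qed.
Let rho1 : rho 1%R = c None. Proof. by case: rhoP. Qed.
Let rho0 : rho 0%R = 1. Proof. exact: coordinate0 rhoP. Qed.
Let rhoN a : rho (- a)%R = (rho a)^-1.
Proof. by apply/eqP; rewrite -mulg_eq1 -rhoD addNr rho0. Qed.

Definition word_val (s : seq (offdiag n * L)) : H :=
  \prod_(x <- s) rho x.2 ^ w x.1.

Lemma word_val_cat s1 s2 : word_val (s1 ++ s2) = word_val s1 * word_val s2.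
Proof. exact: big_cat. Qed.

Lemma word_val_inv s : word_val (word_inv s) = (word_val s)^-1.
Proof.
elim: s => [|x s IH]; first by rewrite /word_val !big_nil invg1.
rewrite /word_inv /= rev_cons -cats1 word_val_cat -/(word_inv s) IH /word_val.
by rewrite big_seq1 big_cons invgM rhoN conjVg.
Qed.

Lemma word_val_pad s k : word_val (s ++ nseq k (ij0, 0%R)) = word_val s.
Proof.
rewrite word_val_cat (_ : word_val (nseq _ _) = 1) ?mulg1 //.
by elim: k => [|k IH]; rewrite /word_val ?big_nil //= big_cons rho0 conj1g mul1g.
Qed.

Lemma word_pad k (s : seq (offdiag n * L)) : (size s <= k)%N ->
  exists p : k.-tuple (offdiag n), exists a : 'I_k -> L,
    word_mx s = word_mx [seq (tnth p i, a i) | i <- enum 'I_k] /\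
    word_val s = \prod_(i < k) rho (a i) ^ w (tnth p i).
Proof.
move=> sk; pose s' := s ++ nseq (k - size s) (ij0, 0%R).
have s'k : size s' == k by rewrite size_cat size_nseq subnKC.
pose t := Tuple s'k.
exists [tuple (tnth t i).1 | i < k], (fun i => (tnth t i).2).
have E : [seq (tnth [tuple (tnth t i).1 | i < k] i, (tnth t i).2) | i <- enum 'I_k] = s'.
  rewrite -[RHS](map_tnth_enum t); apply: eq_map => i.
  by rewrite tnth_mktuple -surjective_pairing.
rewrite E /s' word_mx_cat word_mx_nseq0 mulmx1; split=> //.
rewrite -(word_val_pad s (k - size s)) -/s' -E /word_val big_map.
by rewrite prod_enum_ord.
Qed.

Lemma word_val_eq1 s : (size s <= N + N + N)%N ->
  word_val s = 1 <-> word_mx s = 1%:M%R.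
Proof.
move=> /word_pad[p [a [-> ->]]].
have aP k : root_elt c (rho (a k)) by apply/(coordinate_root rhoP); exists (a k).
have [faith _] := HP; rewrite -(faith p (fun k => rho (a k)) aP).
by rewrite (tr_ringP _ _ rhoP); exact: word_formulaP.
Qed.

Definition SL_mx (A : SL L n) : 'M[L]_n := GL_mx (sgval A).

Lemma SL_mx_inj : injective SL_mx.
Proof. by move=> A B AB; do 2!apply: val_inj. Qed.

Lemma SL_word (A : SL L n) : exists2 s, (size s <= N)%N & SL_mx A = word_mx s.
Proof. by apply: SL_elem_product; exact/eqP/(valP A). Qed.

Definition SL_word_of (A : SL L n) := s2val (cid2 (SL_word A)).

Lemma size_SL_word (A : SL L n) : (size (SL_word_of A) <= N)%N.
Proof. exact: s2valP (cid2 (SL_word A)). Qed.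

Lemma SL_word_ofE (A : SL L n) : word_mx (SL_word_of A) = SL_mx A.
Proof. exact/esym/(s2valP' (cid2 (SL_word A))). Qed.

(** The value does not depend on the chosen word, by [SL_emb_word]. *)
Definition SL_emb (A : SL L n) : H := word_val (SL_word_of A).

Lemma size_word_inv (s : seq (offdiag n * L)) : size (word_inv s) = size s.
Proof. by rewrite size_rev size_map. Qed.

Lemma SL_emb_word (A : SL L n) s : (size s <= N)%N -> word_mx s = SL_mx A ->
  SL_emb A = word_val s.
Proof.
move=> sN sA; apply/esym/divg1_eq; rewrite -word_val_inv -word_val_cat.
apply/word_val_eq1; last first.
  by rewrite word_mx_cat sA -SL_word_ofE; apply: mulmx1C; exact: word_mx_inv.
rewrite size_cat size_word_inv -addnA; apply: leq_add => //.
exact: leq_trans (size_SL_word A) (leq_addr _ _).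
Qed.

Lemma SL_embM : {morph SL_emb : A B / A * B}.
Proof.
move=> A B; apply/esym/divg1_eq; rewrite -word_val_inv -!word_val_cat.
apply/word_val_eq1.
  rewrite !size_cat size_word_inv.
  by apply: leq_add; [apply: leq_add|]; exact: size_SL_word.
rewrite !word_mx_cat !SL_word_ofE; apply: mulmx1C.
have <- : word_mx (SL_word_of (A * B)) = (SL_mx A *m SL_mx B)%R.
  exact: SL_word_ofE.
exact: word_mx_inv.
Qed.

Lemma SL_emb1 : SL_emb 1 = 1.
Proof. by rewrite (@SL_emb_word 1 [::]) // /word_val big_nil. Qed.

Lemma SL_embV A : SL_emb A^-1 = (SL_emb A)^-1.
Proof.
by apply: (mulgI (SL_emb A)); rewrite -SL_embM !mulgV SL_emb1.
Qed.

Lemma SL_emb_inj : injective SL_emb.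
Proof.
move=> A B AB; apply: divg1_eq; set C := A / B.
have : SL_emb C = 1 by rewrite SL_embM SL_embV AB mulgV.
move=> /word_val_eq1 C1; apply: SL_mx_inj.
rewrite -SL_word_ofE C1 //.
exact: leq_trans (size_SL_word C) (leq_trans (leq_addr _ _) (leq_addr _ _)).
Qed.

Definition SL_mk (A : 'M[L]_n) (dA : (\det A = 1)%R) : SL L n :=
  let uA : A \in unitmx := etrans (unitmxE A) (etrans (congr1 (fun x => x \is a GRing.unit) dA) (unitr1 L)) in
  Subgroup (sgval := MkGL uA) (introT eqP dA : MkGL uA \in @SL_pred L n).

Lemma is_wordP g : is_word N c w g <-> exists A, g = SL_emb A.
Proof.
split=> [[p [a [aP ->]]]|[A ->]]; last first.
  have [p [a [_ aE]]] := word_pad (size_SL_word A).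
  exists p, (fun k => rho (a k)); split=> // k.
  by apply/(coordinate_root rhoP); exists (a k).
have /choice[b bE] k : exists b, a k = rho b by exact/(coordinate_root rhoP).
pose s := [seq (tnth p k, b k) | k <- enum 'I_N].
exists (SL_mk (det_word_mx s)); rewrite (@SL_emb_word _ s) //.
  rewrite /word_val big_map prod_enum_ord.
  by apply: eq_bigr => k _; rewrite bE.
by rewrite size_map size_enum_ord.
Qed.

Definition SL_image : {pred H} := [pred g | `[< exists A, g = SL_emb A >]].

Fact SL_image_closed : group_closed SL_image.
Proof.
split=> [|_ _ /asboolP[A ->] /asboolP[B ->]]; apply/asboolP.
  by exists 1; rewrite SL_emb1.
by exists (A / B); rewrite SL_embM SL_embV.
Qed.

HB.instance Definition _ :=
  isMulClosed.Build H SL_image (group_closedM SL_image_closed).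
HB.instance Definition _ := isMul1Closed.Build H SL_image SL_image_closed.1.
HB.instance Definition _ :=
  isInvClosed.Build H SL_image (group_closedV SL_image_closed).

(** Some involution [e] of the frame inverts the unit root element, hence all of
    them, and [~ x, e] = x^-2. Every root element has this form because 2 is
    invertible: otherwise [e] would fix the unit. *)
Lemma rho_commutator a : exists g h, rho a = [~ g, h].
Proof.
have [[e2 [eC _]] [_ [refl nu]]] := cP.
have /existsNP[i ei] := nu.
have ti : torus c (c (Some i)) by move=> j; exact: eC.
have [_ _ _ torusL _] := rhoP; have [s s0 ts] := torusL _ ti.
have us : c None ^ c (Some i) = rho s by rewrite -rho1 ts mul1r.
have uN : c None ^ c (Some i) = (c None)^-1.
  have [uu|//] := refl _ ti (e2 i); case: ei.
  by rewrite [RHS]conjgC uu.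
have sN1 : s = (- 1)%R by apply: rho_inj; rewrite -us uN rhoN rho1.
have two : (2%:R != 0 :> L)%R.
  apply/eqP => two; apply: ei.
  have N1 : (- 1 = 1 :> L)%R by apply/eqP; rewrite eq_sym -addr_eq0 -mulr2n two.
  have uu : c None ^ c (Some i) = c None by rewrite us sN1 N1 rho1.
  by rewrite [RHS]conjgC uu.
exists (rho (- (a / 2%:R))%R), (c (Some i)).
rewrite commgEl ts sN1 mulrN1 opprK -rhoN opprK -rhoD; congr rho.
by rewrite -[LHS](divfK two) mulr_natr mulr2n.
Qed.

(** Commutators are words by [linear_structure], and words are products of
    conjugates of root elements, which are commutators. *)
Lemma derived_image : derived H =i SL_image.
Proof.
move=> g; apply/asboolP/asboolP => [gP|[A ->] S SP].
  have /asboolP // : g \in SL_image.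
  apply: gP => _ [x [y' ->]]; apply/asboolP.
  by have [_ [comm _]] := HP; apply/is_wordP.
rewrite /SL_emb /word_val; apply: gpred_prod => x _.
have [g1 [g2 ->]] := rho_commutator x.2.
by rewrite conjRg; apply: SP; exists (g1 ^ w x.1), (g2 ^ w x.1).
Qed.

Lemma derived_SL : isomorphic (subgroup (derived H)) (SL L n).
Proof.
have /choice[f fE] (x : subgroup (derived H)) : exists A, val x = SL_emb A.
  by apply/asboolP; have := valP x; rewrite derived_image.
have fM : {morph f : x y / x * y}.
  by move=> x x'; apply: SL_emb_inj; rewrite SL_embM -!fE.
have f1 : f 1 = 1 by apply: SL_emb_inj; rewrite SL_emb1 -fE.
pose m := isUMagmaMorphism.Build _ _ f (conj f1 fM).
pose F : UMagmaMorphism.type _ _ := HB.pack f m.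
exists F.
have inv (A : SL L n) : SL_emb A \in derived H.
  by rewrite derived_image; apply/asboolP; exists A.
exists (fun A => Subgroup (inv A)) => [x|A].
  by apply: val_inj; rewrite /= -fE.
by apply: SL_emb_inj; rewrite -fE.
Qed.

Lemma SL_image_conj g A : SL_emb A ^ g \in SL_image.
Proof.
rewrite -[_ ^ g](mulVKg (SL_emb A)) -commgEl; apply: gpredM.
  by apply/asboolP; exists A.
by have [_ [comm _]] := HP; apply/asboolP/is_wordP.
Qed.

Lemma torus_ratio : exists tau : H -> units L,
  forall t, torus c t -> forall a, rho a ^ t = rho (a * \val (tau t))%R.
Proof.
suff /choice[tau tauP] t : exists x : units L,
    torus c t -> forall a, rho a ^ t = rho (a * \val x)%R by exists tau.
have [tP|nt] := pselect (torus c t); last by exists 1 => /nt.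
have [_ _ _ torusL _] := rhoP; have [s s0 ts] := torusL t tP.
by exists (MkUnits s0) => _ a; rewrite ts.
Qed.

(** Write h = x t with [x] a word and [t] in the subtorus; [h] is sent to the
    class of the scalar [tau t] by which [t] dilates root elements. Another
    decomposition changes [t] by a word, and [linear_structure] identifies the
    elements of the subtorus that lie in the product of the derived subgroup
    and the center as those whose dilation is an [n]-th power. *)
Lemma exact_sequence :
  exists p : UMagmaMorphism.type H (quotient (powers L n)),
    short_exact (inclusion (prod_pred (derived H) (center H))) p.
Proof.
have [_ [_ [decomp [SZ reach]]]] := HP.
have [tau tauP] := torus_ratio.
have tauE t : torus c t -> c None ^ t = rho (\val (tau t)).
  by move=> tP; rewrite -rho1 tauP // mul1r.
have tau_eq s t : torus c s -> torus c t -> c None ^ s = c None ^ t -> tau s = tau t.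
  by move=> sP tP; rewrite !tauE // => /rho_inj E; exact: val_inj.
have tauM s t : torus c s -> torus c t -> tau (s * t) = tau s * tau t.
  move=> sP tP; apply/val_inj/rho_inj; rewrite -tauE; last exact: torusM.
  by rewrite conjgM tauE // tauP.
have tau1 : tau 1 = 1.
  by apply: (mulgI (tau 1)); rewrite -tauM ?mulg1 //; exact: torus1.
have tauV t : torus c t -> tau t^-1 = (tau t)^-1.
  move=> tP; apply: (mulgI (tau t)).
  by rewrite -tauM ?mulgV ?tau1 //; exact: torusV.
have torusX t k : torus c t -> torus c (t ^+ k).
  move=> tP; elim: k => [|k IH]; first exact: torus1.
  by rewrite expgS; exact: torusM.
have tauX t k : torus c t -> tau (t ^+ k) = tau t ^+ k.
  move=> tP; elim: k => [|k IH]; first exact: tau1.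
  by rewrite !expgS tauM ?IH //; exact: torusX.
have tau_surj (x : units L) : exists2 t, subtorus c y t & tau t = x.
  have [_ _ _ _ Ltorus] := rhoP; have [t tP tx] := Ltorus _ (valP x).
  have [s [sP st]] := reach t tP; exists s => //; case: sP => sP _.
  by apply/val_inj/rho_inj; rewrite -tauE // st -rho1 tx mul1r.
have subM s t : subtorus c y s -> subtorus c y t -> subtorus c y (s * t).
  move=> [sP sy] [tP ty]; split; first exact: torusM.
  by rewrite -mulgA ty mulgA sy mulgA.
have subV t : subtorus c y t -> subtorus c y t^-1.
  move=> [tP ty]; split; first exact: torusV.
  exact/commute_sym/commuteV/commute_sym.
have SZP t : subtorus c y t ->
    (exists A z, z \in center H /\ t = SL_emb A * z) <-> tau t \in powers L n.
  move=> [tP ty]; have {SZ}[SZ1 SZ2] := SZ t (conj tP ty).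
  split=> [[A [z [/asboolP zP tE]]]|/asboolP[x xE]].
    have [|s [sP sE]] := SZ1; first by exists (SL_emb A), z; split=> //; apply/is_wordP; exists A.
    apply/asboolP; exists (tau s); rewrite -tauX //.
    by apply: tau_eq => //; exact: torusX.
  have [s [sP _] sx] := tau_surj x.
  have [|_ [z [/is_wordP[A ->] [zP tE]]]] := SZ2.
    exists s; split=> //; rewrite !tauE ?tauX ?sx ?xE //; exact: torusX.
  by exists A, z; split=> //; apply/asboolP.
have /choice[tor torP] h : exists t, subtorus c y t /\ exists A, h = SL_emb A * t.
  have [x [t [/is_wordP[A ->] [tP ->]]]] := decomp h.
  by exists t; split=> //; exists A.
pose f h : quotient (powers L n) := coset_of _ (tau (tor h)).
have fE h A t : subtorus c y t -> h = SL_emb A * t -> f h = coset_of (powers L n) (tau t).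
  move=> tP hE; have [sP [B hB]] := torP h.
  apply/coset_eqP; rewrite -tauV -?tauM; first last.
  - by case: sP.
  - by case: tP.
  - by apply: torusV; case: sP.
  apply/SZP; first by apply: subM => //; exact: subV.
  (* With s := tor h, both decompositions give s^-1 * t = (A^-1 * B) ^ s. *)
  have /asboolP[C CE] := SL_image_conj (tor h) (A^-1 * B).
  exists C, 1; rewrite gpred1 mulg1; split=> //.
  rewrite -CE SL_embM SL_embV /conjg -!mulgA -hB.
  by rewrite hE mulKg.
have fM : {morph f : g h / g * h}.
  move=> g h; have [sP [A gE]] := torP g; have [tP [B hE]] := torP h.
  rewrite [RHS]coset_ofM -tauM; [|by case: sP|by case: tP].
  have /asboolP[C CE] := SL_image_conj (tor g)^-1 B.
  apply: (fE _ (A * C)); first exact: subM.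
  rewrite SL_embM -CE /conjg invgK [in LHS]gE [in LHS]hE !mulgA.
  by rewrite mulgVK.
have f1 : f 1 = 1.
  rewrite (fE 1 1 1) ?tau1 //; last by rewrite SL_emb1 mulg1.
  by split; [exact: torus1|rewrite mul1g mulg1].
pose m := isUMagmaMorphism.Build _ _ f (conj f1 fM).
pose p : UMagmaMorphism.type _ _ := HB.pack f m.
exists p; split; first exact: val_inj.
- apply/seteqP; split=> [_ [x _ <-]|h] /=.
    have /asboolP[g [z [gP zP hE]]] := valP x.
    rewrite /= hE; have := gP; rewrite derived_image => /asboolP[A ->].
    have [tP [B zE]] := torP z.
    rewrite (fE _ (A * B) (tor z)) //; last by rewrite SL_embM zE mulgA -zE.
    apply/coset_eqP; rewrite mulg1 gpredV.
    apply/SZP => //; exists B^-1, z; split=> //.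
    by rewrite SL_embV [X in _ * X]zE mulKg.
  move=> fh; have [tP [A hE]] := torP h.
  have /SZP : tau (tor h) \in powers L n.
    by move/coset_eqP: fh; rewrite mulg1 gpredV.
  case=> // B [z [zP tE]].
  have hP : h \in prod_pred (derived H) (center H).
    apply/asboolP; exists (SL_emb (A * B)), z; split=> //.
      by rewrite derived_image; apply/asboolP; exists (A * B).
    by rewrite SL_embM -mulgA -tE.
  by exists (Subgroup hP).
- apply/seteqP; split=> // u _ /=.
  have [t tP tx] := tau_surj (coset_repr u).
  exists t => //; rewrite /= (fE t 1 t) // ?SL_emb1 ?mul1g // tx.
  exact: coset_reprK.
Qed.

End Structure.

(** * Diagonal matrices and transvections *)
Section DiagonalMatrices.
Variables (F : fieldType) (n : nat).
Implicit Types (x t u g : GL F n) (i j k r s : 'I_n) (a b : F) (f : 'I_n -> F).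

Definition GL_of (A : 'M[F]_n) : GL F n := insubd (1 : GL F n) A.

Lemma GL_ofK (A : 'M[F]_n) : A \in unitmx -> GL_mx (GL_of A) = A.
Proof. by move=> uA; rewrite /GL_of -[GL_mx _]/(val _) insubdK. Qed.

Lemma GL_mx_inj : injective (@GL_mx F n).
Proof. exact: val_inj. Qed.

Definition diagonal t := is_diag_mx (GL_mx t).

Lemma diagonal_off t r s : diagonal t -> r != s -> t r s = 0%R.
Proof. by move=> /is_diag_mxP; apply. Qed.

Lemma diagonal_det t : diagonal t -> (\det t = \prod_i t i i)%R.
Proof.
move=> tD; have tE : GL_mx t = diag_mx (\row_i t i i)%R.
  apply/matrixP => r s; rewrite !mxE; case: eqP => [->|/eqP rs]; first by rewrite mulr1n.
  by rewrite (diagonal_off tD).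
by rewrite tE det_diag; apply: eq_bigr => i _; rewrite !mxE eqxx mulr1n.
Qed.

Lemma GL_det_neq0 x : (\det x != 0)%R.
Proof. by rewrite -unitfE -unitmxE (valP x). Qed.

Lemma diagonal_neq0 t i : diagonal t -> t i i != 0%R.
Proof.
move=> tD; apply: contraNneq (GL_det_neq0 t) => ti.
by rewrite diagonal_det // (bigD1 i) //= ti mul0r.
Qed.

Lemma diagonal_mull t x r s : diagonal t -> (t *m x)%R r s = (t r r * x r s)%R.
Proof.
move=> tD; rewrite mxE (bigD1 r) //= big1 ?addr0 // => k kr.
by rewrite (diagonal_off tD) ?mul0r // eq_sym.
Qed.

Lemma diagonal_mulr t x r s : diagonal t -> (x *m t)%R r s = (x r s * t s s)%R.
Proof.
move=> tD; rewrite mxE (bigD1 s) //= big1 ?addr0 // => k ks.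
by rewrite (diagonal_off tD) ?mulr0.
Qed.

Lemma diagonalM t u : diagonal t -> diagonal u -> diagonal (t * u).
Proof.
move=> tD uD; apply/is_diag_mxP => r s rs.
by rewrite diagonal_mull // (diagonal_off uD) ?mulr0.
Qed.

Lemma diagonal1 : diagonal 1.
Proof. by apply/is_diag_mxP => r s /negPf rs; rewrite mxE -val_eqE rs. Qed.

Lemma diagonalC t u : diagonal t -> diagonal u -> t * u = u * t.
Proof.
move=> tD uD; apply/GL_mx_inj/matrixP => r s.
rewrite diagonal_mull // diagonal_mulr // mulrC.
by have [->|rs] := eqVneq r s; rewrite // (diagonal_off uD) // !mul0r.
Qed.

Lemma diagonal_conj u t r s : diagonal t ->
  (u ^ t) r s = ((t r r)^-1 * u r s * t s s)%R.
Proof.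
move=> tD; have : GL_mx (t * u ^ t) r s = GL_mx (u * t) r s by rewrite mulVKg.
move: (u ^ t) => v; rewrite diagonal_mull // diagonal_mulr // -mulrA => <-.
by rewrite mulKf // diagonal_neq0.
Qed.

Lemma diagonal_exp t (k : nat) i : diagonal t ->
  diagonal (t ^+ k) /\ (t ^+ k) i i = (t i i ^+ k)%R.
Proof.
move=> tD; elim: k => [|k [IH1 IH2]].
  by split; [exact: diagonal1|rewrite mxE eqxx].
rewrite expgS; split; first exact: diagonalM.
by rewrite diagonal_mull // IH2 exprS.
Qed.

Lemma diagonal_prod (I : Type) (p : seq I) (P : pred I) (t : I -> GL F n) i :
  (forall l, diagonal (t l)) ->
  diagonal (\prod_(l <- p | P l) t l) /\
  (\prod_(l <- p | P l) t l) i i = (\prod_(l <- p | P l) t l i i)%R.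
Proof.
move=> tD; apply: (big_ind2 (fun x a => diagonal x /\ x i i = a)) => //.
- by split; [exact: diagonal1|rewrite mxE eqxx].
- by move=> x a y b [xD <-] [yD <-]; split; [exact: diagonalM|rewrite diagonal_mull].
Qed.

Lemma diagonal_eq t u : diagonal t -> diagonal u -> (forall i, t i i = u i i) -> t = u.
Proof.
move=> tD uD tu; apply/GL_mx_inj/matrixP => r s.
have [->|rs] := eqVneq r s; first exact: tu.
by rewrite !diagonal_off.
Qed.

Definition diag_GL f := GL_of (diag_mx (\row_i f i)%R).

Lemma diag_GLP f : (forall i, f i != 0%R) ->
  diagonal (diag_GL f) /\ forall i, diag_GL f i i = f i.
Proof.
move=> f0; have fE : GL_mx (diag_GL f) = diag_mx (\row_i f i)%R.
  rewrite GL_ofK // unitmxE unitfE det_diag; apply/prodf_neq0 => i _.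
  by rewrite mxE.
split=> [|i]; last by rewrite fE !mxE eqxx mulr1n.
by rewrite /diagonal fE diag_mx_is_diag.
Qed.

Definition reflection k : GL F n := diag_GL (fun i => if i == k then -1 else 1)%R.

Lemma reflectionP k : diagonal (reflection k) /\
  forall i, reflection k i i = (if i == k then -1 else 1)%R.
Proof. by apply: diag_GLP => i; case: (i == k); rewrite ?oppr_eq0 oner_eq0. Qed.

(** Conjugation by a reflection negates the entries of row [k] and of column
    [k] off the diagonal. *)
Lemma reflection_conj k u r s :
  (u ^ reflection k) r s = (if (r == k) == (s == k) then u r s else - u r s)%R.
Proof.
have [kD kE] := reflectionP k; rewrite diagonal_conj // !kE.
by case: (r == k); case: (s == k);
  rewrite ?invrN ?invr1 ?mulN1r ?mul1r ?mulrN ?mulr1 ?opprK.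
Qed.

Lemma reflectionK k : reflection k * reflection k = 1.
Proof.
have [kD kE] := reflectionP k; apply: diagonal_eq => [||i].
- exact: diagonalM.
- exact: diagonal1.
by rewrite diagonal_mull // kE mxE eqxx; case: eqP; rewrite ?mulN1r ?opprK ?mul1r.
Qed.

Hypothesis two_neq0 : (2%:R != 0 :> F)%R.

Lemma neq_opp a : a != 0%R -> a <> (- a)%R.
Proof.
move=> a0 /eqP; rewrite -addr_eq0 -mulr2n -mulr_natr mulf_eq0.
by rewrite (negbTE a0) (negbTE two_neq0).
Qed.

Lemma diagonal_commute x : (forall k, x ^ reflection k = x) -> diagonal x.
Proof.
move=> xk; apply/is_diag_mxP => r s rs; apply/eqP; apply: contraT => nz.
have := congr1 (fun z : GL F n => z r s) (xk r).
rewrite reflection_conj eqxx eq_sym (negbTE (_ : s != r)) 1?eq_sym //= => /esym.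
by move/(neq_opp nz).
Qed.

Definition transvection i j a : GL F n := GL_of (elem i j a).

Lemma transvectionE i j a : i != j -> GL_mx (transvection i j a) = elem i j a.
Proof. by move=> ij; rewrite GL_ofK // unitmxE det_elem // unitr1. Qed.

Lemma transvection_conj i j a t : i != j -> diagonal t ->
  transvection i j a ^ t = transvection i j (a * (t j j / t i i)).
Proof.
move=> ij tD; apply/GL_mx_inj/matrixP => r s.
rewrite diagonal_conj // !transvectionE // !elemE.
have [<-|rs] := eqVneq r s.
  have [->|ri] := eqVneq r i; last by rewrite !mul0r !addr0 mulr1 mulVf // diagonal_neq0.
  by rewrite (negbTE ij) mulr0 !mul0r !addr0 mulr1 mulVf // diagonal_neq0.
rewrite !add0r; have [->|ri] := eqVneq r i; last by rewrite !mul0r mulr0 mul0r.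
have [->|sj] := eqVneq s j; last by rewrite !mulr0 !mul0r mulr0 mul0r.
by rewrite !mul1r -mulrA mulrC -mulrA.
Qed.

Lemma transvectionM i j a b : i != j -> transvection i j (a + b) = transvection i j a * transvection i j b.
Proof. by move=> ij; apply: GL_mx_inj; rewrite /= !transvectionE // elem_mul. Qed.

Lemma transvection_inj i j : i != j -> injective (transvection i j).
Proof.
move=> ij a b ab; have := congr1 (fun z : GL F n => z i j) ab.
by rewrite !transvectionE // !elemE !eqxx (negbTE ij) !add0r !mul1r.
Qed.

End DiagonalMatrices.

(** * Root elements of the general linear group *)
Section Shape.
Variables (F : fieldType) (n : nat).
Implicit Types (x t u g : GL F n) (i j k r s : 'I_n) (a b : F) (f : 'I_n -> F).
Hypothesis two_neq0 : (2%:R != 0 :> F)%R.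

Lemma mulmx_two (x y : 'M[F]_n) i j : i != j ->
  (forall r s, r != s -> x r s != 0%R -> (r == i) && (s == j) || (r == j) && (s == i)) ->
  (forall s, (x *m y) i s = x i i * y i s + x i j * y j s)%R /\
  (forall s, (x *m y) j s = x j i * y i s + x j j * y j s)%R /\
  (forall k s, k != i -> k != j -> (x *m y) k s = x k k * y k s)%R.
Proof.
move=> ij supp; have zero r s : r != s -> ~~ ((r == i) && (s == j) || (r == j) && (s == i)) ->
    x r s = 0%R.
  by move=> rs nrs; apply/eqP; apply: contraNT nrs; exact: supp.
have ji : j != i by rewrite eq_sym.
split=> [s|]; last split=> [s|k s ki kj].
- rewrite mxE (bigD1 i) //= (bigD1 j) //= big1 ?addr0 // => k /andP[ki kj].
  by rewrite zero ?mul0r ?eqxx ?(negbTE kj) ?(negbTE ij) // eq_sym.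
- rewrite mxE (bigD1 i) //= (bigD1 j) //= big1 ?addr0 // => k /andP[ki kj].
  by rewrite zero ?mul0r ?eqxx ?(negbTE ki) ?(negbTE ji) // eq_sym.
- rewrite mxE (bigD1 k) //= big1 ?addr0 // => l lk.
  by rewrite zero ?mul0r ?(negbTE ki) ?(negbTE kj) // eq_sym.
Qed.

(** Let the entry (i, j) of [u] be nonzero, off the diagonal. The reflection at
    [i] negates it, so it inverts [u]; a reflection at [k] outside {i, j} keeps
    it, so it cannot invert [u] and fixes [u], which confines the support to a
    block. Commuting with a conjugate by diag(1, ..., q, ..., 1) with q^2 <> 1
    then kills the entry (j, i). Finally the diagonal entries have square 1, and
    they are 1 because [u * u], which is not 1 in characteristic other than 2,
    is conjugate to [u] under the torus. *)
Lemma root_shape u :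
  (forall t, diagonal t -> t * t = 1 -> u ^ t = u \/ u ^ t = u^-1) ->
  ~ diagonal u ->
  (forall t, diagonal t -> u * u ^ t = u ^ t * u) ->
  (u * u = 1 \/ exists2 t, diagonal t & u * u = u ^ t) ->
  (exists s : F, s != 0 /\ s * s != 1)%R ->
  exists i j b, [/\ i != j, b != 0%R & u = transvection i j b].
Proof.
move=> refl /negP; rewrite /diagonal => nd comm square [q [q0 q1]].
have /existsP[i /existsP[j /andP[ij uij]]] : [exists i, [exists j, (i != j) && (u i j != 0%R)]].
  apply: contraNT nd => /existsPn h; apply/is_diag_mxP => i j ij; apply/eqP.
  by have /existsPn/(_ j) := h i; rewrite negb_and negbK => /orP[|/negbNE//]; rewrite -val_eqE (negbTE ij).
have ji : j != i by rewrite eq_sym.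
have ui : u ^ reflection F i = u^-1.
  have [uu|//] := refl _ (proj1 (reflectionP F i)) (reflectionK F i).
  have := congr1 (fun z : GL F n => z i j) uu.
  by rewrite reflection_conj eqxx (negbTE ji) /= => /esym/(neq_opp two_neq0 uij).
have uk k : k != i -> k != j -> u ^ reflection F k = u.
  move=> ki kj; have [//|uu] := refl _ (proj1 (reflectionP F k)) (reflectionK F k).
  have := congr1 (fun z : GL F n => z i j) (etrans uu (esym ui)).
  rewrite !reflection_conj eqxx (negbTE ji) (eq_sym i k) (negbTE ki).
  by rewrite (eq_sym j k) (negbTE kj) /= => /(neq_opp two_neq0 uij).
have supp r s : r != s -> u r s != 0%R -> (r == i) && (s == j) || (r == j) && (s == i).
  move=> rs urs.
  have inside k : (r == k) != (s == k) -> (k == i) || (k == j).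
    move=> rsk; apply: contraT; rewrite negb_or => /andP[ki kj].
    have := congr1 (fun z : GL F n => z r s) (uk k ki kj).
    by rewrite reflection_conj (negbTE rsk) => /esym/(neq_opp two_neq0 urs).
  have := inside r; rewrite eqxx eq_sym (eq_sym s) (negbTE rs) => /(_ isT).
  have := inside s; rewrite eqxx (negbTE rs) => /(_ isT).
  case/orP=> /eqP sE /orP[] /eqP rE; rewrite sE rE !eqxx ?orbT //;
    by move: rs; rewrite rE sE eqxx.
have mul_i y := proj1 (mulmx_two y ij supp).
have mul_j y := proj1 (proj2 (mulmx_two y ij supp)).
have mul_k y := proj2 (proj2 (mulmx_two y ij supp)).
set v := u ^ reflection F i.
have vE r s : v r s = (if (r == i) == (s == i) then u r s else - u r s)%R.
  exact: reflection_conj.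
have uv : u * v = 1 by rewrite /v ui mulgV.
have uvE r s : (u *m v)%R r s = (r == s)%:R%R.
  by have := congr1 (fun z : GL F n => z r s) uv; rewrite [X in _ = X -> _]mxE.
have uii : u i i = u j j.
  have := uvE i j; rewrite mul_i !vE !eqxx (negbTE ij) (negbTE ji) /= mulrN (mulrC (u i i)).
  by move/eqP; rewrite addrC subr_eq0 => /eqP/(mulfI uij).
have uji : u j i = 0%R.
  have qP : forall k, (if k == i then q else 1 : F)%R != 0%R.
    by move=> k; case: (k == i); rewrite ?oner_eq0.
  have [tD tE] := diag_GLP qP; set t := diag_GL _ in tD tE.
  have utE r s : (u ^ t) r s = ((t r r)^-1 * u r s * t s s)%R by exact: diagonal_conj.
  have := congr1 (fun z : GL F n => z i i) (comm _ tD) => /=.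
  have supp' r s : r != s -> (u ^ t) r s != 0%R -> (r == i) && (s == j) || (r == j) && (s == i).
    move=> rs nz; apply: supp rs _; apply: contraNneq nz => u0.
    by rewrite utE u0 mulr0 mul0r.
  have [mul_i' _] := mulmx_two u ij supp'.
  rewrite mul_i mul_i' !utE !tE !eqxx (negbTE ji) invr1 mulr1 mul1r => E.
  have {E} : (u j i * (u i j * (q * q - 1)) = 0)%R.
    move: E; rewrite (mulrAC (q^-1)%R) mulVf // mul1r => /addrI E.
    have {}E : (q * (u i j * (u j i * q)) = u i j * u j i)%R.
      by rewrite E !mulrA mulfV // mul1r.
    have -> : (u j i * (u i j * (q * q - 1)) =
               q * (u i j * (u j i * q)) - u i j * u j i)%R by ring.
    by rewrite E subrr.
  move/eqP; rewrite !mulf_eq0 subr_eq0 (negbTE uij) (negbTE q1) !orbF.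
  by move/eqP.
have sqE k : (u *m u)%R k k = (u k k * u k k)%R.
  have [->|ki] := eqVneq k i; first by rewrite mul_i uji mulr0 addr0.
  have [->|kj] := eqVneq k j; first by rewrite mul_j uji mul0r add0r.
  exact: mul_k.
have sq1 k : (u k k * u k k = 1)%R.
  have := uvE k k; rewrite eqxx.
  have [->|ki] := eqVneq k i.
    by rewrite mul_i !vE !eqxx (negbTE ji) /= uji oppr0 mulr0 addr0.
  have [->|kj] := eqVneq k j.
    by rewrite mul_j !vE !eqxx uji mul0r add0r.
  by rewrite mul_k // vE eqxx.
have ukk0 k : u k k != 0%R.
  by apply/eqP => k0; move: (sq1 k) => /eqP; rewrite k0 mul0r eq_sym oner_eq0.
have sq_ij : (u *m u)%R i j = (u i j * u i i * 2%:R)%R.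
  by rewrite mul_i -uii; ring.
have [t tD ut] : exists2 t, diagonal t & u * u = u ^ t.
  have [uu|//] := square.
  have := sq_ij; rewrite (congr1 (fun z : GL F n => z i j) uu : (u *m u)%R i j = _) mxE.
  rewrite (negbTE ij) => /esym/eqP; rewrite !mulf_eq0 (negbTE uij) (negbTE two_neq0).
  by rewrite (negbTE (ukk0 i)).
have u1 k : u k k = 1%R.
  have := congr1 (fun z : GL F n => z k k) ut.
  rewrite /= sqE diagonal_conj // mulrAC mulVf ?diagonal_neq0 // mul1r => E.
  by apply: (mulfI (ukk0 k)); rewrite mulr1.
exists i, j, (u i j); split=> //; apply/GL_mx_inj/matrixP => r s.
rewrite transvectionE // elemE; have [<-|rs] := eqVneq r s.
  rewrite u1; case: eqP => [->|_]; last by rewrite !mul0r addr0.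
  by rewrite (negbTE ij) mulr0 mul0r addr0.
rewrite add0r; have [urs|nz] := eqVneq (u r s) 0%R.
  rewrite urs; case: eqP => [ri|_]; last by rewrite !mul0r.
  case: eqP => [sj|_]; last by rewrite mulr0 mul0r.
  by move: uij; rewrite -ri -sj urs eqxx.
case/orP: (supp r s rs nz) => /andP[/eqP rE /eqP sE].
  by rewrite rE sE !eqxx !mul1r.
by move: nz; rewrite rE sE uji eqxx.
Qed.

End Shape.

(** * Frames of the general linear group *)
Section Frames.
Variables (F : fieldType) (m : nat).
Local Notation n := m.+1.
Implicit Types (x t u g : GL F n) (i j k r s : 'I_n) (a b : F) (c : option 'I_n -> GL F n).
Hypothesis two_neq0 : (2%:R != 0 :> F)%R.

Lemma involution_diagonalizable (A : 'M[F]_n) : (A *m A = 1%:M)%R -> diagonalizable A.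
Proof.
move=> A2; apply/diagonalizableP; exists [:: 1; -1]%R.
  rewrite /= inE andbT; apply/eqP; exact: (neq_opp two_neq0 (oner_neq0 F)).
rewrite big_cons big_seq1; apply: mxminpoly_min.
have -> : (('X - 1%:P) * ('X - (-1)%:P) = 'X ^+ 2 - 1 :> {poly F})%R.
  by rewrite polyCN polyC1; ring.
by rewrite rmorphB rmorphXn rmorph1 /= horner_mx_X expr2 -[(A * A)%R]/(A *m A)%R A2 subrr.
Qed.

Lemma diagonal_square t i : diagonal t -> t * t = 1 -> (t i i == 1)%R || (t i i == -1)%R.
Proof.
move=> tD t2; have := congr1 (fun z : GL F n => z i i) t2.
by rewrite /= diagonal_mull // mxE eqxx => /eqP; rewrite -expr2 sqrf_eq1.
Qed.

(** Commuting involutions are simultaneously diagonalizable. As [n] independent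
    ones generate 2^n distinct diagonal matrices with entries 1 and -1, they
    generate all of these, in particular the reflections; and only diagonal
    matrices commute with all reflections. *)
Lemma frame_diagonal c : frame_involutions c ->
  exists g, forall x, torus c x <-> diagonal (x ^ g).
Proof.
move=> [e2 [eC indep]].
pose As := [seq GL_mx (c (Some i)) | i <- enum 'I_n].
have [P Pu /allP PA] : codiagonalizable As.
  apply/codiagonalizableP; split=> [_ _ /mapP[i _ ->] /mapP[j _ ->]|_ /mapP[i _ ->]].
    exact: (congr1 (@GL_mx F n) (eC i j)).
  apply: involution_diagonalizable; exact: (congr1 (@GL_mx F n) (e2 i)).
have PVu : invmx P \in unitmx by rewrite unitmx_inv.
pose g := GL_of (invmx P); exists g.
have gE x : GL_mx (x ^ g) = conjmx P (GL_mx x).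
  rewrite conjumx // /conjg /= GL_ofK // invmxK.
  by rewrite mulmxA.
pose e i := c (Some i) ^ g.
have eD i : diagonal (e i).
  rewrite /diagonal gE; apply: (PA (GL_mx (c (Some i)))).
  by apply: map_f; rewrite mem_enum.
have ee i : e i * e i = 1 by rewrite -conjMg e2 conj1g.
pose D (S : {set 'I_n}) := \prod_(i in S) e i.
have DP S l : diagonal (D S) /\ D S l l = (\prod_(i in S) e i l l)%R.
  exact: diagonal_prod.
have De S : D S = (\prod_(i in S) c (Some i)) ^ g by rewrite conjg_prod.
have pm S l : (D S l l == 1)%R || (D S l l == -1)%R.
  have [SD _] := DP S l; apply: (@diagonal_square (D S) l SD); apply: diagonal_eq.
  - by apply: diagonalM; exact: (proj1 (DP S l)).
  - exact: diagonal1.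
  move=> k; rewrite diagonal_mull; last exact: (proj1 (DP S l)).
  rewrite (proj2 (DP S k)) -big_split /= big1 ?mxE ?eqxx // => i _.
  have : GL_mx (e i * e i) k k = GL_mx 1 k k by rewrite ee.
  by rewrite diagonal_mull // => ->; rewrite mxE eqxx.
pose phi (S : {set 'I_n}) : {ffun 'I_n -> bool} := [ffun l => (D S l l == 1)%R].
(* The symmetric difference U of two sets with the same sign pattern has trivial
   product, so independence makes it empty. *)
have phi_inj : injective phi.
  move=> S T ST; pose U := (S :\: T) :|: (T :\: S).
  have DU l : (D U l l * (D (S :&: T) l l * D (S :&: T) l l) = D S l l * D T l l)%R.
    rewrite !(proj2 (DP _ _)).
    rewrite [(\prod_(i in S) _)%R](bigID (mem T)) [(\prod_(i in T) _)%R](bigID (mem S)) /=.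
    rewrite [(\prod_(i in U) _)%R](bigID (mem S)) /=.
    have -> : (\prod_(i in S :&: T) e i l l = \prod_(i in S | i \in T) e i l l)%R.
      by apply: eq_bigl => i; rewrite !inE.
    have -> : (\prod_(i in T | i \in S) e i l l = \prod_(i in S | i \in T) e i l l)%R.
      by apply: eq_bigl => i; rewrite andbC.
    have -> : (\prod_(i in U | i \in S) e i l l = \prod_(i in S | i \notin T) e i l l)%R.
      by apply: eq_bigl => i; rewrite !inE; do 2!case: (_ \in _).
    have -> : (\prod_(i in U | i \notin S) e i l l = \prod_(i in T | i \notin S) e i l l)%R.
      by apply: eq_bigl => i; rewrite !inE; do 2!case: (_ \in _).
    by ring.
  have sq S' l : (D S' l l * D S' l l = 1)%R.
    by case/orP: (pm S' l) => /eqP->; rewrite ?mulrNN mulr1.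
  have DST l : D S l l = D T l l.
    have := congr1 (fun f : {ffun 'I_n -> bool} => f l) ST; rewrite !ffunE.
    case/orP: (pm S l) => /eqP->; case/orP: (pm T l) => /eqP-> //; rewrite eqxx.
      by move=> /esym/eqP.
    by move=> /eqP.
  have DU1 : D U = 1.
    apply: diagonal_eq; [exact: (proj1 (DP U ord0))|exact: diagonal1|move=> l].
    have := DU l; rewrite sq mulr1 => ->.
    by rewrite -DST sq mxE eqxx.
  have U0 : U = finset.set0.
    apply/eqP; apply: contraT => /indep; case; apply: (conjg_inj g).
    by rewrite -De DU1 conj1g.
  apply/setP => i; have := congr1 (fun V : {set 'I_n} => i \in V) U0.
  by rewrite !inE; do 2!case: (_ \in _).
have phi_surj f : exists S, phi S = f.
  (* Both types have 2^n elements. *)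
  have [psi _ psiK] : bijective phi.
    apply: inj_card_bij => //.
    by rewrite card_ffun card_bool card_ord -cardsT -powersetT card_powerset cardsT card_ord.
  by exists (psi f).
have reflE k : exists S, D S = reflection F k.
  have [S SE] := phi_surj [ffun l => l != k]; exists S.
  have [kD kE] := reflectionP F k.
  apply: diagonal_eq => // [|l]; first exact: (proj1 (DP S ord0)).
  have := congr1 (fun f : {ffun 'I_n -> bool} => f l) SE; rewrite !ffunE kE.
  case: (l == k) => /=; case/orP: (pm S l) => /eqP-> //; first by rewrite eqxx.
  by move=> /eqP.
move=> x; split=> [xP|xD i].
  apply: (diagonal_commute two_neq0) => k; have [S <-] := reflE k.
  apply/eqP; rewrite conjg_fix; apply/commgP; rewrite De /commute -!conjMg.
  congr (_ ^ g); apply: commute_prod => i _; exact/esym/xP.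
by apply: (conjg_inj g); rewrite !conjMg; exact: diagonalC (eD i) xD.
Qed.

(** A diagonal matrix [t] multiplies the coefficient of an elementary matrix at
    (i, j) by the ratio t_j / t_i. *)
Lemma transvection_coordinate c g i j b : i != j -> b != 0%R ->
  (forall x, torus c x <-> diagonal (x ^ g)) -> c None ^ g = transvection i j b ->
  coordinate c (fun a => transvection i j (a * b) ^ g^-1).
Proof.
move=> ij b0 torusE cE; split.
- by move=> a a' /conjg_inj/(transvection_inj ij)/(mulIf b0).
- by move=> a a'; rewrite mulrDl transvectionM // conjMg.
- by rewrite mul1r -cE conjgK.
- move=> t /torusE tD; exists ((t ^ g)%g j j / (t ^ g)%g i i)%R.
    by rewrite mulf_neq0 ?invr_neq0 // diagonal_neq0.
  move=> a; rewrite -conjgM (_ : g^-1 * t = (t ^ g) * g^-1); last first.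
    by rewrite /conjg -!mulgA mulgV mulg1.
  by rewrite conjgM (transvection_conj _ ij tD) mulrAC.
- move=> s s0.
  have sP k : (if k == j then s else 1 : F)%R != 0%R.
    by case: (k == j); rewrite ?oner_eq0.
  have [tD tE] := diag_GLP sP; set t := diag_GL _ in tD tE.
  exists (t ^ g^-1); first by apply/torusE; rewrite conjgKV.
  by move=> a; rewrite -conjJg (transvection_conj _ ij tD) !tE eqxx (negbTE ij) divr1 /= mulrAC.
Qed.

(** An infinite field has a scalar as required, by [infinite_field_element]. *)
Lemma frame_coordinate c : (exists s : F, s != 0 /\ s * s != 1)%R ->
  frame c -> exists rho : F -> GL F n, coordinate c rho.
Proof.
move=> Fq [invP [[_ [closed [_ _]]] [refl nu]]].
have [g gE] := frame_diagonal invP.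
have toT t : diagonal t -> torus c (t ^ g^-1) by move=> tD; apply/gE; rewrite conjgKV.
have conjE t : (c None ^ g) ^ t = (c None ^ (t ^ g^-1)) ^ g.
  by rewrite -!conjgM; congr (_ ^ _); rewrite /conjg invgK !mulgA mulgVK.
have rootT t : torus c t -> root_elt c (c None ^ t) by move=> tP; right; exists t.
have [||t tD|||i [j [b [ij b0 uE]]]] := @root_shape _ _ two_neq0 (c None ^ g).
- move=> t tD t2; rewrite conjE; have [|->|->] := refl _ (toT t tD).
  + by rewrite -conjMg t2 conj1g.
  + by left.
  + by right; rewrite conjVg.
- by move/gE.
- rewrite conjE -!conjMg; congr (_ ^ g).
  by have [] := closed _ _ (root_unit c) (rootT _ (toT t tD)).
- have [[u2|[t [tP tE]]] _] := closed _ _ (root_unit c) (root_unit c).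
    by left; rewrite -conjMg u2 conj1g.
  right; exists (t ^ g); first exact/gE.
  by rewrite -conjMg tE conjJg.
- exact: Fq.
by eexists; exact: (transvection_coordinate ij b0 gE uE).
Qed.

End Frames.

(** * The standard frame *)
Section Standard.
Variables (F : fieldType) (m : nat).
Local Notation n := m.+2.
Implicit Types (x t u g : GL F n) (i j k r s : 'I_n) (a b : F).
Hypothesis two_neq0 : (2%:R != 0 :> F)%R.

Let i0 : 'I_n := ord0.
Let i1 : 'I_n := lift ord0 ord0.
Let i01 : i0 != i1. Proof. by []. Qed.

Definition std_frame (o : option 'I_n) : GL F n :=
  if o is Some k then reflection F k else transvection i0 i1 1%R.
Local Notation c0 := std_frame.

Lemma std_torus x : torus c0 x <-> diagonal x.
Proof.
split=> [xP|xD i]; last by apply: diagonalC => //; case: (reflectionP F i).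
apply: (diagonal_commute two_neq0) => k.
by apply/eqP; rewrite conjg_fix; apply/commgP/esym/xP.
Qed.

Definition std_rho a : GL F n := transvection i0 i1 a.

Lemma std_coordinate : coordinate c0 std_rho.
Proof.
have -> : std_rho = fun a => transvection i0 i1 (a * 1)%R ^ 1^-1.
  by apply: funext => a; rewrite mulr1 invg1 conjg1.
apply: transvection_coordinate; rewrite ?oner_eq0 ?conjg1 //.
by move=> x; rewrite conjg1; exact: std_torus.
Qed.

Lemma std_frameP : frame c0.
Proof.
split; first split; last split.
- by move=> i; exact: reflectionK.
- split=> [i j|S S0].
    by apply: diagonalC; [case: (reflectionP F i)|case: (reflectionP F j)].
  have /set0Pn[k kS] := S0 => E.
  have [_] := @diagonal_prod F n _ (index_enum _) (mem S) (@reflection F n) k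
    (fun l => proj1 (reflectionP F l)).
  rewrite E mxE eqxx (bigD1 k) //= (proj2 (reflectionP F k)) eqxx big1 => [/eqP|i /andP[_ ik]].
    by rewrite mulr1 => /eqP; exact: (neq_opp two_neq0 (oner_neq0 F)).
  by rewrite (proj2 (reflectionP F i)) eq_sym (negbTE ik).
- apply: (coordinate_root_field std_coordinate) => s t /std_torus sD /std_torus tD.
  exact: diagonalC.
- split=> [t /std_torus tD t2|/std_torus/is_diag_mxP/(_ i0 i1 i01)].
    rewrite /= (transvection_conj _ i01 tD) mul1r.
    have transN : (transvection i0 i1 1 : GL F n)^-1 = transvection i0 i1 (-1)%R.
      apply/eqP; rewrite eq_sym -mulg_eq1 -transvectionM // addNr.
      by apply/eqP/GL_mx_inj; rewrite transvectionE // elem0.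
    case/orP: (diagonal_square i0 tD t2) => /eqP->;
      case/orP: (diagonal_square i1 tD t2) => /eqP->;
      rewrite ?invrN ?invr1 ?mulrNN ?mulr1 ?mul1r ?transN; by [left | right].
  rewrite transvectionE // elemE !eqxx /= add0r !mul1r => /eqP.
  by rewrite oner_eq0.
Qed.

Definition std_perm (ij : offdiag n) : 'S_n :=
  (tperm i0 (val ij).1 * tperm (tperm i0 (val ij).1 i1) (val ij).2)%g.

Lemma std_permE (ij : offdiag n) :
  std_perm ij i0 = (val ij).1 /\ std_perm ij i1 = (val ij).2.
Proof.
case: ij => [[i j] /= ij]; rewrite /std_perm /= !permM tpermL tpermL; split=> //.
have ki : tperm i0 i i1 != i by rewrite -{2}(tpermL i0 i) (inj_eq perm_inj).
by apply: tpermD; rewrite // eq_sym.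
Qed.

(** Conjugation by these permutation matrices carries the root group at (0, 1)
    to the one at any other position. *)
Definition std_weyl (ij : offdiag n) : GL F n := GL_of (perm_mx (std_perm ij)).

Lemma std_weylP ij a :
  std_rho a ^ std_weyl ij = transvection (val ij).1 (val ij).2 a.
Proof.
have [p0 p1] := std_permE ij; set p := std_perm ij in p0 p1.
have pE : GL_mx (std_weyl ij) = perm_mx p.
  by rewrite GL_ofK // unitmx_perm.
apply: (mulgI (std_weyl ij)); rewrite mulVKg; apply: GL_mx_inj.
rewrite -[LHS]/(GL_mx (std_rho a) *m GL_mx (std_weyl ij))%R.
rewrite -[RHS]/(GL_mx (std_weyl ij) *m GL_mx (transvection (val ij).1 (val ij).2 a))%R.
rewrite !transvectionE ?(valP ij) // pE; apply/matrixP => r s.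
rewrite elem_mulE mul_elemE !mxE p1 -p0 (inj_eq perm_inj).
by rewrite (eq_sym s); ring.
Qed.

Lemma std_word_val (w : seq (offdiag n * F)) :
  GL_mx (word_val std_weyl std_rho w) = word_mx w.
Proof.
elim: w => [|x w IH]; first by rewrite /word_val big_nil.
rewrite /word_val big_cons std_weylP -/(word_val _ _ w).
rewrite -[LHS]/(GL_mx (transvection _ _ _) *m GL_mx (word_val _ _ _))%R IH.
by rewrite transvectionE //; exact: (valP x.1).
Qed.

Let ij0 : offdiag n := exist _ (i0, i1) i01.

Lemma std_is_word g : is_word (SL_width n) c0 std_weyl g <-> (\det g = 1)%R.
Proof.
split=> [[p [a [aP ->]]]|].
  have /choice[b bE] (l : 'I__) : exists b, a l = std_rho b.
    exact/(coordinate_root std_coordinate).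
  rewrite -(det_word_mx [seq (tnth p l, b l) | l <- enum 'I__]) -std_word_val.
  congr (\det (GL_mx _))%R; rewrite /word_val big_map prod_enum_ord.
  by apply: eq_bigr => l _; rewrite bE.
move=> /SL_elem_product[w wN gE].
have [p [a [_ aE]]] := word_pad std_weyl ij0 std_coordinate wN.
exists p, (fun l => std_rho (a l)); split=> [l|].
  by apply/(coordinate_root std_coordinate); exists (a l).
by rewrite -aE; apply: GL_mx_inj; rewrite std_word_val.
Qed.

(** A unitriangular matrix with ones in row 1 to the right of the diagonal: a
    diagonal matrix commutes with it exactly when all its entries, except
    possibly the one of index 0, are equal. *)
Definition std_mixer : GL F n :=
  GL_of (\matrix_(r, s) ((r == s) || (r == i1) && (s != i0))%:R)%R.

Lemma std_mixerE r s : std_mixer r s = ((r == s) || (r == i1) && (s != i0))%:R%R.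
Proof.
rewrite GL_ofK ?mxE // -unitmx_tr unitmxE det_trig.
  by rewrite big1 ?unitr1 // => i _; rewrite !mxE eqxx.
apply/is_trig_mxP => i j lt_ij; rewrite !mxE.
have -> : j == i = false by rewrite -val_eqE /= gtn_eqF.
by case: eqP => //= j1; move: lt_ij; rewrite j1 /= ltnS leqn0 -val_eqE /= => ->.
Qed.

Lemma std_subtorus t : subtorus c0 std_mixer t <->
  diagonal t /\ forall k, k != i0 -> t k k = t i1 i1.
Proof.
rewrite /subtorus; split=> [[/std_torus tD ty]|[tD tE]].
  split=> // k k0; have : GL_mx (t * std_mixer) i1 k = GL_mx (std_mixer * t) i1 k.
    by rewrite ty.
  rewrite diagonal_mull // diagonal_mulr // !std_mixerE eqxx k0 orbT /=.
  by rewrite mulr1 mul1r => ->.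
split; first exact/std_torus.
apply/GL_mx_inj/matrixP => r s; rewrite diagonal_mull // diagonal_mulr // std_mixerE.
have [->|rs] := eqVneq r s; first by rewrite mulrC.
rewrite /=; have [->|r1] := eqVneq r i1; last by rewrite mulr0 mul0r.
by have [->|s0] := eqVneq s i0; rewrite ?mulr0 ?mul0r //= mulr1 mul1r tE.
Qed.

Lemma central_scalar z : (forall g, z * g = g * z) ->
  diagonal z /\ forall k, z k k = z i0 i0.
Proof.
move=> zC; have zD : diagonal z by apply/std_torus => i.
split=> // k; have [->//|k0] := eqVneq k i0.
have : GL_mx (z * transvection k i0 1) k i0 = GL_mx (transvection k i0 1 * z) k i0 by rewrite zC.
rewrite diagonal_mull // diagonal_mulr // transvectionE // elemE !eqxx (negbTE k0).
by rewrite add0r !mul1r mulr1.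
Qed.

Definition two_diag a b := diag_GL (fun k : 'I_n => if k == i0 then a else b).

Lemma two_diagP a b : a != 0%R -> b != 0%R ->
  [/\ diagonal (two_diag a b), two_diag a b i0 i0 = a
    & forall k, k != i0 -> two_diag a b k k = b].
Proof.
move=> a0 b0; have [|tD tE] := @diag_GLP F n (fun k : 'I_n => if k == i0 then a else b).
  by move=> i; case: (i == i0).
by split=> [||k /negbTE k0] //; rewrite tE ?k0 ?eqxx.
Qed.

Lemma two_diag_subtorus a b : a != 0%R -> b != 0%R ->
  subtorus c0 std_mixer (two_diag a b).
Proof.
move=> a0 b0; have [tD _ tE] := two_diagP a0 b0.
by apply/std_subtorus; split=> // k k0; rewrite !tE.
Qed.

Lemma std_det t : diagonal t -> (forall k, k != i0 -> t k k = t i1 i1) ->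
  (\det t = t i0 i0 * t i1 i1 ^+ m.+1)%R.
Proof.
move=> tD tE; rewrite diagonal_det // big_ord_recl; congr (_ * _)%R.
rewrite (eq_bigr (fun _ => t i1 i1)) ?prodr_const ?card_ord // => i _.
by rewrite tE.
Qed.

Lemma std_unit_conj t : diagonal t ->
  c0 None ^ t = std_rho (t i1 i1 / t i0 i0)%R.
Proof. by move=> tD; rewrite /= (transvection_conj _ i01 tD) mul1r. Qed.

Lemma std_rho_inj : injective std_rho.
Proof. exact: transvection_inj. Qed.

Lemma std_linear : linear_structure (SL_width n) c0 std_weyl std_mixer.
Proof.
have neq0 t i : diagonal t -> t i i != 0%R := @diagonal_neq0 F n t i.
split; [|split; [|split; [|split]]].
- move=> p a aP; have /choice[b bE] (l : 'I__) : exists b, a l = std_rho b.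
    exact/(coordinate_root std_coordinate).
  have -> : a = fun l => std_rho (b l) by exact: funext.
  rewrite (tr_ringP _ _ std_coordinate); apply: (iff_trans (word_formulaP _ _)).
  rewrite -std_word_val /word_val big_map prod_enum_ord.
  by split=> [E|->] //; exact: GL_mx_inj.
- move=> g h; apply/std_is_word.
  rewrite /commg /conjg /= !det_mulmx !det_inv.
  have [gn hn] := (GL_det_neq0 g, GL_det_neq0 h).
  by rewrite mulrCA mulKf // mulVf.
- move=> g; have [tD t0 t1] := two_diagP (GL_det_neq0 g) (oner_neq0 F).
  set t := two_diag _ _ in tD t0 t1.
  exists (g / t), t; rewrite mulgVK; split; last first.
    by split=> //; exact: (two_diag_subtorus (GL_det_neq0 g) (oner_neq0 F)).
  apply/std_is_word; rewrite /= det_mulmx det_inv (std_det tD); last first.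
    by move=> k k0; rewrite !t1.
  by rewrite t0 t1 // expr1n mulr1 mulfV // GL_det_neq0.
- move=> t /std_subtorus[tD tE]; have [t00 t10] := (neq0 t i0 tD, neq0 t i1 tD).
  split=> [[x [z [/std_is_word x1 [/central_scalar[zD zE] txz]]]]|[s [/std_torus sD]]].
    have z0 := neq0 z i0 zD.
    have dt : (t i0 i0 * t i1 i1 ^+ m.+1 = z i0 i0 ^+ m.+2)%R.
      rewrite -std_det // txz /= det_mulmx x1 mul1r diagonal_det //.
      by rewrite (eq_bigr (fun _ => z i0 i0)) ?prodr_const ?card_ord.
    have q0 : (t i1 i1 / z i0 i0 != 0)%R by rewrite mulf_neq0 ?invr_neq0.
    have [sD s0 s1] := two_diagP (oner_neq0 F) q0.
    (* From t_0 t_1^(n-1) = z^n, the ratio t_1 / t_0 equals (t_1 / z)^n. *)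
    exists (two_diag 1 (t i1 i1 / z i0 i0)%R); split; first exact/std_torus.
    have [sX _] := diagonal_exp n i0 sD.
    rewrite !std_unit_conj // !(proj2 (diagonal_exp _ _ sD)) s0 s1 // expr1n divr1.
    congr std_rho; rewrite expr_div_n -dt invfM exprS.
    by field; rewrite t00 expf_neq0.
  have [sX _] := diagonal_exp n i0 sD; have [s0 s1] := (neq0 s i0 sD, neq0 s i1 sD).
  rewrite !std_unit_conj // !(proj2 (diagonal_exp _ _ sD)) => /std_rho_inj tq.
  pose q := (s i1 i1 / s i0 i0)%R; have q0 : (q != 0)%R by rewrite mulf_neq0 ?invr_neq0.
  have {}tq : (t i1 i1 = q ^+ n * t i0 i0)%R.
    by rewrite /q expr_div_n -tq divfK.
  (* The scalar zeta satisfies zeta^n = t_0 t_1^(n-1), the determinant of t. *)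
  pose zeta := (t i1 i1 / q)%R; have zeta0 : (zeta != 0)%R by rewrite mulf_neq0 ?invr_neq0.
  have [zD z0 z1] := two_diagP zeta0 zeta0; set z := two_diag _ _ in zD z0 z1.
  have zE k : z k k = zeta by have [->|/z1] := eqVneq k i0.
  exists (t / z), z; rewrite mulgVK; split; last (split=> // g).
    apply/std_is_word; rewrite /= det_mulmx det_inv !std_det //; last first.
      by move=> k _; rewrite !zE.
    rewrite !zE -exprS expr_div_n [X in (X * _)%R]mulrC exprS.
    rewrite [X in (_ * X / _)%R](_ : t i0 i0 = t i1 i1 / q ^+ n)%R; last first.
      by rewrite tq mulrAC mulfV ?mul1r // expf_neq0.
    by rewrite !exprS; field; rewrite q0 t10 !expf_neq0.
  apply/GL_mx_inj/matrixP => r s'.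
  by rewrite diagonal_mull // diagonal_mulr // !zE mulrC.
- move=> t /std_torus tD; exists (two_diag (t i0 i0) (t i1 i1)).
  have [t00 t10] := (neq0 t i0 tD, neq0 t i1 tD).
  have [sD s0 s1] := two_diagP t00 t10.
  by split; [exact: two_diag_subtorus|rewrite !std_unit_conj // s0 s1].
Qed.

End Standard.

(** * Centers *)
Definition central (G : groupType) (_ : void -> G) (x : G) : Prop :=
  forall y, x * y = y * x.

Definition group_graph (f : symbol group_signature) (G : groupType)
    (_ : void -> G) : ('I_(arity f) -> G) -> G -> Prop :=
  match f return ('I_(@arity group_signature f) -> G) -> G -> Prop with
  | GOne => fun z y => y = 1
  | GInv => fun z y => y = (z ord0)^-1
  | GMul => fun z y => y = z ord0 * z ord_max
  end.

(** For instance the inclusion of the center, or the scalar matrices. *)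
Definition parametrizes_center (A G : groupType) (rho : A -> G) : Prop :=
  [/\ injective rho, {morph rho : x y / x * y}
    & forall x, (forall y, x * y = y * x) <-> exists a, x = rho a].

Lemma parametrizes_center_interprets (A G : groupType) (rho : A -> G)
    (c : void -> G) :
  parametrizes_center rho ->
  interprets (S := group_signature) central group_graph c
    (N := group_structure A) rho.
Proof.
move=> [rho_inj rhoM centerP]; split=> // f z b.
have rho1 : rho 1 = 1 by apply: (mulgI (rho 1)); rewrite -rhoM !mulg1.
have rhoV a : rho a^-1 = (rho a)^-1.
  by apply: (mulgI (rho a)); rewrite -rhoM !mulgV.
case: f z => z /=.
- by rewrite -rho1; split=> [/rho_inj|->].
- by rewrite -rhoV; split=> [/rho_inj|->].
- by rewrite -rhoM; split=> [/rho_inj|->].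
Qed.

(** The center is interpreted without parameters. *)
Lemma center_equiv (H G A B : groupType) (f : A -> H) (g : B -> G) :
  group_equiv H G -> parametrizes_center f -> parametrizes_center g ->
  group_equiv A B.
Proof.
move=> HG fP gP.
suff imp (phi : sentence group_signature) :
    satisfies (group_structure A) phi -> satisfies (group_structure B) phi.
  move=> phi; split=> [|Bphi]; first exact: imp.
  by apply: contrapT => Aphi; exact: (imp (FNot phi)) Aphi Bphi.
pose noparam (K : groupType) (v : void) : K := match v with end.
pose noarg (K : groupType) (i : 'I_0) : K := False_rect K (notF (ltn_ord i)).
have noargs (M K : groupType) (h : M -> K) : noarg K = (fun i => h (noarg M i)).
  by apply: funext => -[].
pose P (K : groupType) := tr_formula central group_graph phi (noparam K) (noarg K).
move=> Aphi; suff /(transfer HG) : definable (fun K (_ : void -> K) => P K).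
  rewrite /P (noargs A H f) (noargs B G g) => HGP.
  have /HGP : tr_formula central group_graph phi (noparam H) (fun i => f (noarg A i)).
    exact/(tr_formulaP (parametrizes_center_interprets _ fP)).
  by move=> /(tr_formulaP (parametrizes_center_interprets _ gP)).
have : definable (fun K (e : void -> K) => tr_formula central group_graph phi
    (fun v => e v) (fun i => e (False_rect void (notF (ltn_ord i))))).
  apply: def_tr_formula; first by rewrite /central; definability.
  by case; rewrite /group_graph; definability.
move=> /def_iff; apply=> K e.
rewrite /P (_ : noparam K = fun v => e v); last by apply: funext.
by rewrite (_ : noarg K = fun i => e (False_rect void (notF (ltn_ord i)))) //; apply: funext => -[].
Qed.

Lemma parametrizes_center_val (H : groupType) :
  parametrizes_center (fun x : subgroup (center H) => val x).
Proof.
split=> //; first exact: val_inj.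
move=> x; split=> [xP|[z ->]]; last exact/asboolP/(valP z).
have xC : x \in center H by apply/asboolP.
by exists (Subgroup xC).
Qed.

Lemma parametrizes_center_GL (F : fieldType) (m : nat) :
  (2%:R != 0 :> F)%R ->
  parametrizes_center (fun a : units F => diag_GL (fun _ : 'I_m.+2 => \val a)).
Proof.
move=> two_neq0.
have aP (a : units F) := @diag_GLP F m.+2 (fun _ => \val a) (fun _ => valP a).
split=> [a b ab|a b|x].
- apply: val_inj; have [[_ aE] [_ bE]] := (aP a, aP b).
  by rewrite -(aE ord0) -(bE ord0) ab.
- have [[abD abE] [[aD aE] [bD bE]]] := (aP (a * b), (aP a, aP b)).
  apply: diagonal_eq => // [|i]; first exact: diagonalM.
  by rewrite abE diagonal_mull // aE bE.
split=> [/(central_scalar two_neq0)[xD xE]|[a ->] y].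
  exists (MkUnits (diagonal_neq0 ord0 xD)).
  have [aD aE] := aP (MkUnits (diagonal_neq0 ord0 xD)).
  by apply: diagonal_eq => // i; rewrite aE xE.
have [aD aE] := aP a; apply/GL_mx_inj/matrixP => r s.
by rewrite diagonal_mull // diagonal_mulr // !aE mulrC.
Qed.

(** * Groups elementarily equivalent to a general linear group *)

Lemma infinite_field_element (F : fieldType) :
  infinite_set [set: F]%classic -> exists s : F, (s != 0 /\ s * s != 1)%R.
Proof.
move=> Finf; apply: contrapT => none; apply: Finf.
apply: (@sub_finite_set _ _ [set` [:: 0; 1; -1 : F]%R]%classic); last exact: finite_seq.
move=> s _ /=; rewrite !inE; apply: contraT; rewrite negb_or => /andP[s0 s1].
by case: none; exists s; split=> //; rewrite -expr2 sqrf_eq1.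
Qed.

Theorem theoremA4 (n : nat) (F : fieldType) (H : groupType) :
  (3 <= n)%N ->
  infinite_set [set: F]%classic ->
  2%N \notin [pchar F]%R ->
  group_equiv H (GL F n) ->
  exists L : fieldType,
    [/\ field_equiv L F,
        isomorphic (subgroup (derived H)) (SL L n),
        group_equiv (subgroup (center H)) (units F)
      & exists p : UMagmaMorphism.type H (quotient (powers L n)),
          short_exact (inclusion (prod_pred (derived H) (center H))) p].
Proof.
case: n => [//|[//|m]] _ Finf char2 HG.
have two_neq0 : (2%:R != 0 :> F)%R by move: char2; rewrite inE.
pose good (G : groupType) (c : option 'I_m.+2 -> G) w y :=
  frame c /\ linear_structure (SL_width m.+2) c w y.
have [c [w [y [cP HP]]]] : exists (c : option 'I_m.+2 -> H) w y, good H c w y.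
  apply: (transfer (P := fun G => exists c w y, good G c w y) (fun phi => iff_sym (HG phi))).
    do 2!(apply: def_exists_fun); apply: def_exists; apply: def_and.
      exact: def_frame.
    exact: def_linear_structure.
  exists (@std_frame F m), (@std_weyl F m), (@std_mixer F m).
  by split; [exact: std_frameP|exact: std_linear].
have [_ [rootP _]] := cP; have [L [rho rhoP]] := exists_coordinate rootP.
have ij0 : offdiag m.+2 by exists (ord0, lift ord0 ord0).
exists L; split.
- apply: (coordinate_equiv HG cP rhoP) => c' c'P.
  by apply: frame_coordinate => //; exact: infinite_field_element.
- exact: derived_SL ij0 cP rhoP HP.
- exact: center_equiv HG (parametrizes_center_val H) (parametrizes_center_GL m two_neq0).
- exact: exact_sequence ij0 cP rhoP HP.
Qed.
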